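(* For a finite-dimensional smooth manifold $M$ (second-countable and Hausdorff), regarded as a sample-smooth space, $TM$ is the classical tangent bundle of $M$ (i.e. $[\gamma]\mapsto\gamma'(0)$ is an isomorphism in $\mathbf{SSS}$ from $TM$ onto the classical tangent bundle, itself a manifold regarded as a sample-smooth space), $\pi_M$ is the classical projection, and $Tf$ is the classical differential for every smooth map $f$ between such manifolds.
   Context: **Sample space.** $\Omega=[0,1]^{\mathbb{N}}$; $\mathcal{B}_\Omega$ is the universal completion of its Borel (product) $\sigma$-algebra, i.e. all universally measurable subsets; $\Omega^\Omega$ is the set of all $\mathcal{B}_\Omega$-$\mathcal{B}_\Omega$-measurable self-maps of $\Omega$. **Site.** $\Omega_n:=\mathbb{R}^n\times\Omega$, $n\ge0$. A map $g:\Omega_m\to\mathbb{R}^n$ is mixed-smooth, $g\in\mathcal{C}^\infty_{\mathrm{mix}}(\Omega_m,\mathbb{R}^n)$, if (M1) $g(-,\omega)\in C^\infty(\mathbb{R}^m,\mathbb{R}^n)$ for every $\omega$, and (M2) $g(t,-)$ is $\mathcal{B}_\Omega$-Borel measurable for every $t$. The category $\mathbb{S}$ has objects $\Omega_n$ and morphisms $\mathbb{S}(\Omega_m,\Omega_n)=\{(g,\Phi): g\in\mathcal{C}^\infty_{\mathrm{mix}}(\Omega_m,\mathbb{R}^n),\Phi\in\Omega^\Omega\}$, where $(g,\Phi)(t,\omega)=(g(t,\omega),\Phi(\omega))$. **Sample-smooth spaces.** A sample-smooth space is a set $\mathcal{X}$ with, for each $n\ge0$, a set $\mathcal{X}^{\Omega_n}$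 of maps $\Omega_n\to\mathcal{X}$ (plots) containing all constant maps and such that $p\in\mathcal{X}^{\Omega_n}$, $h\in\mathbb{S}(\Omega_m,\Omega_n)$ imply $p\circ h\in\mathcal{X}^{\Omega_m}$. A map $f:\mathcal{X}\to\mathcal{Y}$ is sample-smooth (a morphism of $\mathbf{SSS}$) if $f\circ p\in\mathcal{Y}^{\Omega_n}$ for all $n$ and $p\in\mathcal{X}^{\Omega_n}$. $\mathbb{R}^k$ carries the plots $\mathcal{C}^\infty_{\mathrm{mix}}(\Omega_n,\mathbb{R}^k)$. A manifold $M$ carries as plots the maps $p:\Omega_n\to M$ with $p(-,\omega)\in C^\infty(\mathbb{R}^n,M)$ for all $\omega$ and $p(t,-)$ $\mathcal{B}_\Omega$-Borel measurable for all $t$; sample-smooth maps between such manifolds are exactly the smooth maps. For a surjection $q:\mathcal{X}\to\mathcal{Q}$ the quotient structure is $\mathcal{Q}^{\Omega_n}=\{\text{constants}\}\cup q\circ\mathcal{X}^{\Omega_n}$. The function space $\mathcal{Y}^{\mathcal{X}}$ is $\mathbf{SSS}(\mathcal{X},\mathcal{Y})$ with plots those $F:\Omega_n\to\mathcal{Y}^{\mathcal{X}}$ such that for all $m$, $h\in\mathbb{S}(\Omega_m,\Omega_n)$, $q\in\mathcal{X}^{\Omega_m}$ one has $(u\mapsto F(h(u))(q(u)))\in\mathcal{Y}^{\Omega_m}$. **Tangent bundle.** On the function space $\mathcal{X}^{\mathbb{R}}$ let $\gamma\sim\eta$ iff $\gamma(0)=\eta(0)$ and $(f\circ\gamma)'(0)=(f\circ\eta)'(0)$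 for all $f\in\mathbf{SSS}(\mathcal{X},\mathbb{R})$. $T\mathcal{X}:=\mathcal{X}^{\mathbb{R}}/\!\sim$ with the quotient structure, and $\pi_{\mathcal{X}}:T\mathcal{X}\to\mathcal{X}$, $[\gamma]\mapsto\gamma(0)$. For $f:\mathcal{X}\to\mathcal{Y}$ sample-smooth, $Tf[\gamma]:=[f\circ\gamma]$. *)

(* Defs.v *)
From HB Require Import structures.
From mathcomp Require Import all_boot all_order all_algebra generic_quotient.
From mathcomp Require Import all_classical all_reals all_analysis.
From mathcomp Require Import interval_inference.

Set Implicit Arguments.
Unset Strict Implicit.
Unset Printing Implicit Defensive.

Import Order.TTheory GRing.Theory Num.Theory.
Import numFieldNormedType.Exports.

Local Open Scope classical_set_scope.
Local Open Scope ring_scope.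
Local Open Scope quotient_scope.

Definition Omega (R : realType) : Type := nat -> {i01 R}.

HB.instance Definition _ (R : realType) := gen_eqMixin (Omega R).
HB.instance Definition _ (R : realType) := gen_choiceMixin (Omega R).
HB.instance Definition _ (R : realType) :=
  isPointed.Build (Omega R) (fun=> 0%:i01).

(* The subbasic open sets of the product topology, which is second countable, so
   that they generate its Borel sigma-algebra. *)
Definition cylinders (R : realType) : set (set (Omega R)) :=
  [set A | exists n (B : set R),
     open B /\ A = [set w : Omega R | B (w n)%:num]].

(* In the completion of the Borel sigma-algebra by every probability measure. *)
Definition universally_measurable (R : realType) : set (set (Omega R)) :=
  [set A | forall P : probability (g_sigma_algebraType (@cylinders R)) R,
     exists2 B : set (g_sigma_algebraType (@cylinders R)),
       measurable B & P.-negligible (A `+` B)].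

Lemma universally_measurable0 (R : realType) :
  universally_measurable (set0 : set (Omega R)).
Proof.
by move=> P; exists set0; rewrite ?setYK; [exact: measurable0
  |exact: negligible_set0].
Qed.

Lemma universally_measurableC (R : realType) (A : set (Omega R)) :
  universally_measurable A -> universally_measurable (~` A).
Proof.
move=> mA P; have [B mB AB] := mA P; exists (~` B); first exact: measurableC.
suff -> : ~` A `+` ~` B = A `+` B by [].
rewrite /setY !setDE !setCK; apply/seteqP; split=> w /=; tauto.
Qed.

Lemma universally_measurableU (R : realType) (A : (set (Omega R))^nat) :
  (forall i, universally_measurable (A i)) ->
  universally_measurable (\bigcup_i A i).
Proof.
move=> mA P.
have /choice[B BP] : forall i,
    exists B : set (g_sigma_algebraType (@cylinders R)),
      measurable B /\ P.-negligible (A i `+` B).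
  by move=> i; have [B mB AB] := mA i P; exists B.
exists (\bigcup_i B i).
  by apply: bigcupT_measurable => i; have [] := BP i.
have sub : \bigcup_i A i `+` \bigcup_i B i `<=` \bigcup_i (A i `+` B i).
  move=> w [[[i _ Aiw] nB]|[[i _ Biw] nA]]; exists i => //.
    by left; split=> // Biw; apply: nB; exists i.
  by right; split=> // Aiw; apply: nA; exists i.
apply: (@negligibleS _ (g_sigma_algebraType (@cylinders R)) _ P _ _ sub).
by apply: negligible_bigcup => i; have [] := BP i.
Qed.

HB.instance Definition _ (R : realType) :=
  @isMeasurable.Build (sigma_display (@universally_measurable R)) (Omega R)
    (@universally_measurable R) (@universally_measurable0 R)
    (@universally_measurableC R) (@universally_measurableU R).

(* [measurable_fun] would require the codomain to be pointed, hence nonempty. *)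
Definition borel_measurable (R : realType) (T : topologicalType)
    (f : Omega R -> T) : Prop :=
  forall B : set T, <<s @open T >> B -> measurable (f @^-1` B).

Definition partial_along (R : realType) (m n : nat) (s : seq 'I_m)
    (f : 'rV[R]_m -> 'rV[R]_n) : 'rV[R]_m -> 'rV[R]_n :=
  foldr (fun i g x => 'D_(delta_mx 0 i) g x) f s.

(* Meant for open [U]: the iterated partial derivatives at the points of [U]
   then only depend on the restriction of [f] to [U]. *)
Definition smooth_on (R : realType) (m n : nat) (U : set 'rV[R]_m)
    (f : 'rV[R]_m -> 'rV[R]_n) : Prop :=
  forall (s : seq 'I_m) (x : 'rV[R]_m), U x ->
    {for x, continuous (partial_along s f)} /\
    forall i, derivable (partial_along s f) x (delta_mx 0 i).

Record chart (R : realType) (T : topologicalType) (n : nat) := Chart {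
  chart_dom : set T;
  chart_map :> T -> 'rV[R]_n }.

(* The data of a manifold: a space with an atlas, not assumed to be maximal.
   The axioms are in [is_manifold]. *)
Record mfd (R : realType) := Mfd {
  mfd_space :> topologicalType;
  mfd_dim : nat;
  atlas : set (chart R mfd_space mfd_dim) }.

Definition charts_at (R : realType) (M : mfd R) (x : M)
    : set (chart R M (mfd_dim M)) :=
  [set c | atlas c /\ chart_dom c x].

Definition is_local_homeo (R : realType) (T : topologicalType) (n : nat)
    (c : chart R T n) : Prop :=
  [/\ open (chart_dom c), set_inj (chart_dom c) c,
      {within chart_dom c, continuous c} &
      forall V : set T, V `<=` chart_dom c -> open V -> open (c @` V)].

(* [d \o f \o c^-1] on [c @` chart_dom c] (where [c] is injective), and 0
   elsewhere. *)
Definition coord_rep (R : realType) (S T : topologicalType) (m n : nat)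
    (c : chart R S m) (d : chart R T n) (f : S -> T) : 'rV[R]_m -> 'rV[R]_n :=
  fun u => xget 0 [set d (f y) | y in [set y | chart_dom c y /\ c y = u]].

Definition coord_dom (R : realType) (S T : topologicalType) (m n : nat)
    (c : chart R S m) (d : chart R T n) (f : S -> T) : set 'rV[R]_m :=
  c @` (chart_dom c `&` f @^-1` chart_dom d).

Definition is_manifold (R : realType) (M : mfd R) : Prop :=
  [/\ hausdorff_space M, @second_countable M,
      forall x : M, charts_at x !=set0,
      forall c, @atlas R M c -> is_local_homeo c &
      forall c d, @atlas R M c -> @atlas R M d ->
        smooth_on (coord_dom c d id) (coord_rep c d id)].

Definition smooth_map (R : realType) (M N : mfd R) (f : M -> N) : Prop :=
  continuous f /\
  forall c d, atlas c -> atlas d ->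
    smooth_on (coord_dom c d f) (coord_rep c d f).

Definition euclidean (R : realType) (n : nat) : mfd R :=
  @Mfd R 'rV[R]_n n [set Chart setT id].

(* A tangent vector at [x] is a family of vectors of [R^n], indexed by the
   charts of the atlas at [x], which transforms under changes of charts by the
   differential of the transition map. *)
Record tvec (R : realType) (M : mfd R) := Tvec {
  tbase : M;
  tcomp : chart R M (mfd_dim M) -> 'rV[R]_(mfd_dim M);
  tcomp_change : forall c d, charts_at tbase c -> charts_at tbase d ->
    tcomp d = 'D_(tcomp c) (coord_rep c d id) (c tbase);
  (* irrelevant components are normalized, so that equality is correct *)
  tcomp_out : forall c, ~ charts_at tbase c -> tcomp c = 0 }.

Definition tchart (R : realType) (M : mfd R) (c : chart R M (mfd_dim M))
    (p : tvec M) : 'rV[R]_(mfd_dim M + mfd_dim M) :=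
  row_mx (c (tbase p)) (tcomp p c).

HB.instance Definition _ (R : realType) (M : mfd R) := gen_eqMixin (tvec M).
HB.instance Definition _ (R : realType) (M : mfd R) := gen_choiceMixin (tvec M).

Definition tvec_subbase (R : realType) (M : mfd R) : set (set (tvec M)) :=
  [set W | exists c (O : set 'rV[R]_(mfd_dim M + mfd_dim M)),
     [/\ atlas c, open O &
         W = [set p | chart_dom c (tbase p) /\ O (tchart c p)]]].

HB.instance Definition _ (R : realType) (M : mfd R) :=
  @isSubBaseTopological.Build (tvec M) (set (tvec M)) (@tvec_subbase R M) id.

Definition tangent_bundle (R : realType) (M : mfd R) : mfd R :=
  @Mfd R (tvec M) (mfd_dim M + mfd_dim M)
    [set Chart [set p : tvec M | chart_dom c (tbase p)] (tchart c)
       | c in @atlas R M].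

(* [q = df(p)] as a relation: it determines [q] when [M] and [N] are covered by
   charts. *)
Definition is_differential (R : realType) (M N : mfd R) (f : M -> N)
    (p : tvec M) (q : tvec N) : Prop :=
  tbase q = f (tbase p) /\
  forall c d, charts_at (tbase p) c -> charts_at (f (tbase p)) d ->
    tcomp q d = 'D_(tcomp p c) (coord_rep c d f) (c (tbase p)).

Definition Omega_ (R : realType) (n : nat) : Type := 'rV[R]_n * Omega R.

Definition mixed_smooth (R : realType) (m n : nat)
    (g : Omega_ R m -> 'rV[R]_n) : Prop :=
  (forall w, smooth_on setT (fun t => g (t, w))) /\
  (forall t, borel_measurable (fun w => g (t, w))).

Definition site_map (R : realType) (m n : nat)
    : set (Omega_ R m -> Omega_ R n) :=
  [set h | exists (g : Omega_ R m -> 'rV[R]_n) (Phi : Omega R -> Omega R),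
     [/\ mixed_smooth g, measurable_fun setT Phi &
         h = fun u => (g u, Phi u.2)]].

(* The data of a sample-smooth space; the axioms are in [is_sss]. *)
Record sss (R : realType) := Sss {
  sss_sort :> Type;
  plot : forall n, set (Omega_ R n -> sss_sort) }.

Definition is_sss (R : realType) (X : sss R) : Prop :=
  (forall n (x : X), plot (fun _ : Omega_ R n => x)) /\
  (forall m n (p : Omega_ R n -> X) (h : Omega_ R m -> Omega_ R n),
     plot p -> site_map h -> plot (p \o h)).

Definition sample_smooth (R : realType) (X Y : sss R) (f : X -> Y) : Prop :=
  forall n (p : Omega_ R n -> X), plot p -> plot (f \o p).

Record sss_hom (R : realType) (X Y : sss R) := SssHom {
  sss_hom_fun :> X -> Y;
  sss_homP : sample_smooth sss_hom_fun }.

HB.instance Definition _ (R : realType) (X Y : sss R) :=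
  gen_eqMixin (sss_hom X Y).
HB.instance Definition _ (R : realType) (X Y : sss R) :=
  gen_choiceMixin (sss_hom X Y).

Lemma sample_smooth_comp (R : realType) (X Y Z : sss R)
    (g : Y -> Z) (f : X -> Y) :
  sample_smooth g -> sample_smooth f -> sample_smooth (g \o f).
Proof. by move=> hg hf n p /hf /hg. Qed.

Definition sss_comp (R : realType) (X Y Z : sss R) (g : sss_hom Y Z)
    (f : sss_hom X Y) : sss_hom X Z :=
  SssHom (sample_smooth_comp (sss_homP g) (sss_homP f)).

Definition sss_iso (R : realType) (X Y : sss R) (f : X -> Y) : Prop :=
  [/\ is_sss X, is_sss Y, sample_smooth f &
      exists g : Y -> X, [/\ cancel f g, cancel g f & sample_smooth g]].

(* [R] is identified with the space [R^1] of row vectors. *)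
Definition real_sss (R : realType) : sss R :=
  @Sss R R (fun n => [set p : Omega_ R n -> R |
    mixed_smooth (fun u => const_mx (p u) : 'rV[R]_1)]).

Definition mfd_sss (R : realType) (M : mfd R) : sss R :=
  @Sss R M (fun n => [set p : Omega_ R n -> M |
    (forall w, smooth_map (fun t : euclidean R n => p (t, w))) /\
    (forall t, borel_measurable (fun w => p (t, w)))]).

Definition quot_sss (R : realType) (X : sss R) (Q : Type) (q : X -> Q)
    : sss R :=
  @Sss R Q (fun n => [set p : Omega_ R n -> Q |
    (exists y, p = fun=> y) \/
    exists2 p0 : Omega_ R n -> X, plot p0 & p = q \o p0]).

Definition fun_sss (R : realType) (X Y : sss R) : sss R :=
  @Sss R (sss_hom X Y) (fun n => [set F : Omega_ R n -> sss_hom X Y |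
    forall m (h : Omega_ R m -> Omega_ R n) (q : Omega_ R m -> X),
      site_map h -> plot q -> @plot R Y m (fun u => F (h u) (q u))]).

Notation curve X := (sss_hom (real_sss _) X).

Definition tangent_rel (R : realType) (X : sss R) (gamma eta : curve X)
    : bool :=
  `[< gamma 0 = eta 0 /\
      forall f : sss_hom X (real_sss R),
        derive1 (f \o gamma : R -> R) 0 = derive1 (f \o eta : R -> R) 0 >].

Lemma tangent_rel_equiv (R : realType) (X : sss R) :
  equiv_class_of (@tangent_rel R X).
Proof.
split=> [a|a b|b a c].
- exact/asboolP.
- by apply/asboolP/asboolP => -[e1 e2]; split=> // f; rewrite e2.
- move=> /asboolP[e1 e2] /asboolP[e3 e4]; apply/asboolP.
  by split=> [|f]; [rewrite e1|rewrite e2].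
Qed.

Canonical tangent_equiv (R : realType) (X : sss R) :=
  EquivRelPack (tangent_rel_equiv X).

Definition tangent_type (R : realType) (X : sss R) : Type :=
  {eq_quot (tangent_equiv X)}.

Definition tangent_class (R : realType) (X : sss R) (gamma : curve X)
    : tangent_type X :=
  \pi_({eq_quot (tangent_equiv X)}) gamma.

Definition tangent (R : realType) (X : sss R) : sss R :=
  @quot_sss R (fun_sss (real_sss R) X) (tangent_type X) (@tangent_class R X).

Definition tangent_repr (R : realType) (X : sss R) (tau : tangent X)
    : curve X :=
  repr (tau : {eq_quot (tangent_equiv X)}).

Lemma tangent_reprK (R : realType) (X : sss R) :
  cancel (@tangent_repr R X) (@tangent_class R X).
Proof. by move=> tau; exact: reprK. Qed.

Lemma tangent_classP (R : realType) (X : sss R) (gamma eta : curve X) :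
  reflect (tangent_class gamma = tangent_class eta) (tangent_rel gamma eta).
Proof. by apply: (iffP idP) => /eqmodP. Qed.

Definition tangent_proj (R : realType) (X : sss R) (tau : tangent X) : X :=
  tangent_repr tau 0.

Lemma tangent_projE (R : realType) (X : sss R) (gamma : curve X) :
  tangent_proj (tangent_class gamma : tangent X) = gamma 0.
Proof.
by have /tangent_classP/asboolP[] := tangent_reprK (tangent_class gamma).
Qed.

Definition tangent_map (R : realType) (X Y : sss R) (f : sss_hom X Y)
    (tau : tangent X) : tangent Y :=
  tangent_class (sss_comp f (tangent_repr tau)).

Lemma tangent_mapE (R : realType) (X Y : sss R) (f : sss_hom X Y)
    (gamma : curve X) :
  tangent_map f (tangent_class gamma) = tangent_class (sss_comp f gamma).
Proof.
have /tangent_classP/asboolP[e1 e2] := tangent_reprK (tangent_class gamma).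
apply/tangent_classP/asboolP; split; first by rewrite /= e1.
by move=> g; exact: (e2 (sss_comp g f)).
Qed.

(* [p = gamma'(0)] as a relation: it determines [p] when [M] is covered by
   charts. *)
Definition is_velocity (R : realType) (M : mfd R) (gamma : curve (mfd_sss M))
    (p : tvec M) : Prop :=
  tbase p = gamma 0 /\
  forall c, charts_at (gamma 0 : M) c ->
    tcomp p c = derive1 (c \o gamma : R -> 'rV[R]_(mfd_dim M)) 0.

Definition is_velocity_map (R : realType) (M : mfd R)
    (E : tangent (mfd_sss M) -> mfd_sss (tangent_bundle M)) : Prop :=
  forall gamma : curve (mfd_sss M), is_velocity gamma (E (tangent_class gamma)).

(* Main.v *)
From mathcomp Require Import all_boot all_order all_algebra.
From mathcomp Require Import all_classical all_reals all_analysis.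
From mathcomp Require Import ring lra.
Require Import Defs.

Set Implicit Arguments.
Unset Strict Implicit.
Unset Printing Implicit Defensive.

Import Order.TTheory GRing.Theory Num.Theory.
Import numFieldNormedType.Exports.

Local Open Scope classical_set_scope.
Local Open Scope ring_scope.

(** The proof follows the classical identification of equivalence classes of
    curves with tangent vectors; the point is to do everything along plots.

    A curve in [M] has a velocity, which chart by chart is a vector of R^n.  Two
    curves with the same base point are equivalent exactly when their velocities
    agree.  Bump functions times coordinates are sample-smooth and detect every
    coordinate of the velocity ([tangent_rel_velocity]).  Conversely, a
    sample-smooth function [f] is only known to be smooth along plots; but a ball
    of a chart, reparametrized by the whole of R^n, is a plot, and [f] composed
    with a curve is [f] composed with that plot, composed with the curve read in
    the chart, so that its derivative depends on the velocity only
    ([velocity_tangent_rel]).  Hence [gamma |-> gamma'(0)] is well defined and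
    injective on classes.

    It is sample-smooth.  A plot of curves is a plot [G (t, s, w)] of [M] with one
    more real variable, and the velocity is its partial derivative in [s] at 0,
    which is smooth in [t] ([velocity_plot_smooth]).  In [w] it is a pointwise
    limit of difference quotients, and limits of Borel maps into second countable
    regular spaces are Borel ([borel_limit], [velocity_plot_borel]).

    The substance is the inverse.  A plot of tangent vectors must be lifted to a
    plot of curves, smoothly in the parameter and measurably in the sample, so
    that a choice of a curve for each vector will not do.  The lift comes from one
    map [L : TM * R -> M], continuous, smooth along plots, with
    [L (v, 0) = pi v] and [d/ds L (v, s) = v] at [s = 0] ([local_addition]); then
    [p] lifts to [L (p, -)].  The map [L] is built chart by chart: inside a single
    chart one can move a point [y] by a bounded amount, equal to
    [s a(y) a(pi v) v] to first order, where the cutoff [a] is supported in the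
    chart ([chart_stepper]); this is the identity when [a] vanishes at [pi v].  For a
    locally finite countable family of such moves whose cutoffs have no common
    zero ([stepper_family]), perform all of them in turn, starting from [pi v].
    Near a given [v] only finitely many are not the identity, and the velocities
    add up to [(sum_i a_i(pi v)^2) v]; dividing [s] by this positive sum gives
    [L].

    Three ingredients support this.  Calculus in R^n: continuous partial
    derivatives give differentiability ([C1_differentiable]), smooth maps compose
    ([ck_comp]), and exp(-1/t) yields bump functions.  The tangent bundle is again
    a manifold ([tangent_manifold]).  Finally, a map that is continuous in one
    variable and measurable in the other can be composed with measurable maps
    ([borel_caratheodory]); this is what makes precomposition with morphisms of
    the site preserve plots ([is_sss_mfd]). *)

(** * Continuous partial derivatives imply differentiability *)

Lemma row_norm_coord (R : realType) n (v : 'rV[R]_n) j : `|v 0 j| <= `|v|.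
Proof.
rewrite [leRHS]/Num.Def.normr/= mx_normrE.
exact: (le_bigmax _ (fun ij : 'I_1 * 'I_n => `|v ij.1 ij.2|) (0, j)).
Qed.

Lemma row_norm_le (R : realType) n (v : 'rV[R]_n) e :
  0 <= e -> (forall j, `|v 0 j| <= e) -> `|v| <= e.
Proof.
move=> e0 H; rewrite [leLHS]/Num.Def.normr/= mx_normrE bigmax_le// => -[i j] _ /=.
by rewrite ord1.
Qed.

Lemma row_norm_lt (R : realType) n (v : 'rV[R]_n) e :
  0 < e -> (forall j, `|v 0 j| < e) -> `|v| < e.
Proof.
move=> e0 H; rewrite [ltLHS]/Num.Def.normr/= mx_normrE bigmax_lt// => -[i j] _ /=.
by rewrite ord1.
Qed.

Lemma cvg_rowP (R : realType) n T (F : set_system T) {FF : Filter F}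
    (f : T -> 'rV[R]_n) (l : 'rV[R]_n) :
  f @ F --> l <-> forall j, f x 0 j @[x --> F] --> l 0 j.
Proof.
split=> [fl j|fl].
  apply: (@cvg_comp _ _ _ f (fun M : 'rV[R]_n => M 0 j) _ _ _ fl).
  exact: coord_continuous.
apply/cvgrPdist_le => e e0; near=> x.
apply: row_norm_le; first exact: ltW.
move=> j; rewrite !mxE; move: j; near: x.
apply: filter_forall => j.
by have /cvgrPdist_le := fl j; exact.
Unshelve. all: by end_near. Qed.

Lemma mulmxr_continuous (R : realType) m n (C : 'M[R]_(m, n)) :
  continuous (mulmxr C : 'rV[R]_m -> 'rV[R]_n).
Proof.
move=> x; apply/(@cvg_rowP _ _ _ (nbhs x)) => j /=.
under eq_fun do rewrite mxE.
rewrite mxE.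
apply: cvg_big => [|i _]; first exact: add_continuous.
apply: cvgM; last exact: cvg_cst.
exact: coord_continuous.
Qed.

Lemma differentiable_of_linear (R : realType) (V W : normedModType R)
    (f : V -> W) (df : {linear V -> W}) x :
  continuous df -> f \o shift x = cst (f x) + df +o_ 0 id ->
  differentiable f x.
Proof.
move=> cdf fdf; have E := diff_unique cdf fdf.
by apply/diff_locallyP; rewrite E.
Qed.

(** By the mean value theorem on the segment from [p] to [p + a e]; the reference
    slope [c] will be the partial derivative at a nearby point. *)
Lemma segment_bound (R : realType) m (f : 'rV[R]_m -> R) (p e : 'rV[R]_m)
    (a c eps : R) :
  (forall t, `|t| <= `|a| -> derivable f (t *: e + p) e) ->
  (forall t, `|t| <= `|a| -> `|'D_e f (t *: e + p) - c| <= eps) ->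
  `|f (a *: e + p) - f p - a * c| <= eps * `|a|.
Proof.
move=> df bf.
pose g := fun t : R => f (t *: e + p).
have dg t : `|t| <= `|a| -> is_derive t (1:R) g ('D_e f (t *: e + p)).
  move=> ta.
  have E : (fun h : R => h^-1 *: ((f \o shift (t *: e + p)) (h *: e) - f (t *: e + p)))
         = (fun h : R => h^-1 *: ((g \o shift t) (h *: 1) - g t)).
    apply/funext => h; rewrite /g /=; congr (_ *: (f _ - _)).
    by rewrite addrA -scalerDl [h *: 1]mulr1.
  have := df t ta; rewrite /derivable E => d1.
  by apply: DeriveDef => //; rewrite /derive -E.
have cg t : `|t| <= `|a| -> {for t, continuous g}.
  move=> ta; apply: differentiable_continuous; apply/derivable1_diffP.
  by have [] := dg t ta.
have E0 : g 0 = f p by rewrite /g scale0r add0r.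
have [a0|a0] := leP 0 a.
  have ita x : x \in `[0, a] -> `|x| <= `|a|.
    by rewrite in_itv/= => /andP[x0 xa]; rewrite !ger0_norm.
  have [x /ita xa] : exists2 c, c \in `[0, a]%R &
      g a - g 0 = 'D_e f (c *: e + p) * (a - 0).
    apply: MVT_segment => //.
      move=> x xa; apply: dg; apply: ita.
      exact: subset_itv_oo_cc xa.
    apply/continuous_in_subspaceT => x /set_mem xa.
    by apply: cg; apply: ita.
  rewrite E0 subr0 /g => ->.
  rewrite mulrC -mulrBr normrM mulrC ler_wpM2r//; exact: bf.
have ita x : x \in `[a, 0] -> `|x| <= `|a|.
  rewrite in_itv/= => /andP[x0 xa]; rewrite !ler0_norm ?lerN2//.
  by rewrite ltW.
have [x /ita xa] : exists2 c, c \in `[a, 0]%R &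
    g 0 - g a = 'D_e f (c *: e + p) * (0 - a).
  apply: MVT_segment => //.
  - exact: ltW.
  - move=> x xa; apply: dg; apply: ita.
    exact: subset_itv_oo_cc xa.
  apply/continuous_in_subspaceT => x /set_mem xa.
  by apply: cg; apply: ita.
rewrite E0 sub0r mulrN => /eqP.
rewrite -eqr_oppLR opprB => /eqP; rewrite /g => ->.
rewrite mulrC -mulrBr normrM mulrC ler_wpM2r//; exact: bf.
Qed.

(** The increment of [f] from [x] to [h + x] is telescoped along a path which
    switches on the coordinates of [h] one after the other.  Each leg is parallel
    to an axis, so that [segment_bound] compares it with a partial derivative at
    [x]. *)
Lemma C1_differentiable (R : realType) m n (f : 'rV[R]_m -> 'rV[R]_n) x :
  (\forall y \near x, forall i, derivable f y (delta_mx 0 i)) ->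
  (forall i, {for x, continuous ('D_(delta_mx 0 i) f)}) ->
  differentiable f x.
Proof.
move=> df cdf.
pose C : 'M[R]_(m, n) := \matrix_(i, j) ('D_(delta_mx 0 i) f x) 0 j.
apply: (@differentiable_of_linear _ _ _ f (mulmxr C)).
  exact: mulmxr_continuous.
apply/eqaddoP => _/posnumP[e].
(* each of the m legs may cost [e' * `|h|]; the 1 avoids a division by zero *)
pose e' := e%:num / (m%:R + 1).
have e'0 : 0 < e' by rewrite divr_gt0// ltr_wpDl.
have : \forall y \near x, forall i, derivable f y (delta_mx 0 i) /\
    `|'D_(delta_mx 0 i) f y - 'D_(delta_mx 0 i) f x| <= e'.
  near=> y => i; split; first by move: i; near: y.
  move: i; near: y; apply: filter_forall => i.
  by have /cvgrPdistC_le/(_ e' e'0) := cdf i.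
move=> /nbhs_ballP[_/posnumP[d] xd].
near=> h.
rewrite /= [X in `|X|](_ : _ = f (h + x) - (f x + h *m C)) //.
apply: row_norm_le; first by rewrite mulr_ge0.
move=> j; rewrite !mxE.
(* the path passes through the points [hk k + x] *)
pose hk (k : nat) : 'rV[R]_m := \row_i (if (i < k)%N then h 0 i else 0).
have hkS (k : 'I_m) : hk k.+1 = h 0 k *: delta_mx 0 k + hk k.
  apply/rowP => i; rewrite !mxE ltnS eqxx/= leq_eqVlt -val_eqE/=.
  by case: ltngtP => // ik; rewrite ?(mulr1,mulr0,addr0,add0r)// (val_inj ik).
have hkm : hk m = h by apply/rowP => i; rewrite mxE ltn_ord.
have hk0 : hk 0 = 0 by apply/rowP => i; rewrite !mxE.
pose F k := f (hk k + x) 0 j.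
have T : F m - F 0%N = \sum_(i < m) (F i.+1 - F i).
  by rewrite -(big_mkord xpredT (fun i => F i.+1 - F i)) telescope_sumr.
have Fm : F m = f (h + x) 0 j by rewrite /F hkm.
have F0 : F 0%N = f x 0 j by rewrite /F hk0 add0r.
rewrite -Fm -F0 opprD addrA T -sumrB.
apply: le_trans (ler_norm_sum _ _ _) _.
have B (i : 'I_m) : `|F i.+1 - F i - h 0 i * C i j| <= e' * `|h|.
  rewrite /F hkS -[h 0 i *: _ + _ + _]addrA.
  pose fj y := f y 0 j.
  have near_seg t : `|t| <= `|h 0 i| ->
      ball x d%:num (t *: delta_mx 0 i + (hk i + x)).
    move=> th; rewrite -ball_normE /= -opprB normrN addrA addrK.
    have : `|h| < d%:num.
      near: h; apply/nbhs_ballP; exists d%:num => //= z.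
      by rewrite -ball_normE/= sub0r normrN.
    apply: le_lt_trans; apply: row_norm_le => // k; rewrite !mxE eqxx/=.
    case: eqVneq => [->|ki]; rewrite ?ltnn ?(mulr1,mulr0,addr0,add0r).
      exact: le_trans th (row_norm_coord _ _).
    by case: ifP => _; rewrite ?normr0//; exact: row_norm_coord.
  apply: (le_trans (y := e' * `|h 0 i|)); last first.
    by rewrite ler_wpM2l ?(ltW e'0)//; exact: row_norm_coord.
  have := @segment_bound _ _ fj (hk i + x) (delta_mx 0 i) (h 0 i) (C i j) e'.
  apply => t /near_seg/xd/(_ i)[dd b].
    by have /derivable_mxP/(_ 0 j) := dd.
  have -> : 'D_(delta_mx 0 i) fj (t *: delta_mx 0 i + (hk i + x)) =
       ('D_(delta_mx 0 i) f (t *: delta_mx 0 i + (hk i + x))) 0 j.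
    by rewrite (derive_mx dd) mxE.
  apply: le_trans b.
  by rewrite [C]lock; apply: le_trans (row_norm_coord _ j); rewrite -lock !mxE.
apply: (@le_trans _ _ (\sum_(i < m) e' * `|h|)); first exact: ler_sum.
rewrite sumr_const card_ord -mulr_natl mulrA ler_wpM2r// /e' mulrA ler_pdivrMr//.
  by rewrite mulrC ler_wpM2l// lerDl.
Unshelve. all: by end_near. Qed.

(** * Germs of class C^k *)

Notation ebase i := (delta_mx 0 i).

Section Ck.
Variable R : realType.

(** Germs of class C^k.  Recursion on the order through all first partial
    derivatives is what closure under composition needs, whereas [smooth_on] fixes
    a list of directions. *)
Fixpoint ck (k : nat) m (W : normedModType R) (f : 'rV[R]_m -> W)
    (x : 'rV[R]_m) : Prop :=
  if k is k'.+1 then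
    (\forall y \near x, {for y, continuous f} /\
       forall i, derivable f y (ebase i)) /\
    (forall i, ck k' ('D_(ebase i) f) x)
  else \forall y \near x, {for y, continuous f}.

Lemma near_near (T : topologicalType) (P : T -> Prop) (x : T) :
  (\forall y \near x, P y) -> \forall y \near x, \forall z \near y, P z.
Proof. by move=> /nbhs_interior. Qed.

Lemma near_all (T : topologicalType) (P : T -> Prop) (x : T) :
  (forall y, P y) -> \forall y \near x, P y.
Proof. by move=> H; exact: filterE. Qed.

Lemma near_forall (T : topologicalType) (I : finType) (P : I -> T -> Prop)
    (x : T) :
  (forall i, \forall y \near x, P i y) -> \forall y \near x, forall i, P i y.
Proof. exact: filter_forall. Qed.

Lemma near_eq_continuous (T U : topologicalType) (f g : T -> U) (x : T) :
  (\forall y \near x, f y = g y) -> {for x, continuous f} ->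
  {for x, continuous g}.
Proof.
move=> fg cf; have E : f x = g x := nbhs_singleton fg.
suff : g y @[y --> x] --> f x by rewrite E.
by apply: cvg_trans cf; exact: near_eq_cvg.
Qed.

Lemma ck_near k m (W : normedModType R) (f g : 'rV[R]_m -> W) x :
  (\forall y \near x, f y = g y) -> ck k f x -> ck k g x.
Proof.
elim: k W f g => [|k IH] W f g /= fg.
  move=> cf; have fg' := near_near fg.
  near=> y; apply: (@near_eq_continuous _ _ f); by near: y.
move=> [H1 H2]; have fg' := near_near fg; split.
  near=> y.
  have fgy : \forall z \near y, f z = g z by near: y.
  have [cy dy] : {for y, continuous f} /\ forall i, derivable f y (ebase i).
    by near: y.
  split; first exact: near_eq_continuous cy.
  by move=> i; exact: near_eq_derivable (dy i).
move=> i; apply: (IH _ ('D_(ebase i) f)) (H2 i).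
near=> y; apply: near_eq_derive.
by near: y.
Unshelve. all: by end_near. Qed.

Lemma ckS k m (W : normedModType R) (f : 'rV[R]_m -> W) x :
  ck k.+1 f x -> ck k f x.
Proof.
elim: k W f => [|k IH] W f /= [H1 H2].
  by apply: filterS H1 => y [].
by split=> // i; apply: IH (H2 i).
Qed.

Lemma ck0W k m (W : normedModType R) (f : 'rV[R]_m -> W) x :
  ck k f x -> ck 0 f x.
Proof. by elim: k => // k IH /ckS/IH. Qed.

Lemma ck_continuous k m (W : normedModType R) (f : 'rV[R]_m -> W) x :
  ck k f x -> {for x, continuous f}.
Proof. by move=> /ck0W/= /nbhs_singleton. Qed.

Lemma ck_cst k m (W : normedModType R) (w : W) x :
  ck k (fun _ : 'rV[R]_m => w) x.
Proof.
elim: k w => [|k IH] w /=.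
  by apply: near_all => y; exact: (@cst_continuous _ _ w).
split.
  apply: near_all => y; split; first exact: (@cst_continuous _ _ w).
  by move=> i; exact: derivable_cst.
move=> i; apply: (ck_near _ (IH 0)); apply: near_all => y.
by rewrite (derive_cst w).
Qed.

Lemma ckD k m (W : normedModType R) (f g : 'rV[R]_m -> W) x :
  ck k f x -> ck k g x -> ck k (fun y => f y + g y) x.
Proof.
elim: k W f g => [|k IH] W f g /=.
  by apply: filterS2 => y; exact: continuousD.
move=> [H1 H2] [K1 K2]; split.
  apply: filterS2 H1 K1 => y [cf df] [cg dg].
  split; first exact: continuousD.
  by move=> i; exact: derivableD.
move=> i; apply: ck_near (IH _ _ _ (H2 i) (K2 i)).
apply: filterS2 H1 K1 => y [_ df] [_ dg].
by apply/esym/deriveD.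
Qed.

(** The Leibniz rule expresses the partial derivatives by products of maps of
    class C^k. *)
Lemma ckM k m (f g : 'rV[R]_m -> R) x :
  ck k f x -> ck k g x -> ck k (fun y => f y * g y) x.
Proof.
elim: k f g => [|k IH] f g.
  by apply: filterS2 => y; exact: continuousM.
move=> F G; have [H1 H2] := F; have [K1 K2] := G; split.
  apply: filterS2 H1 K1 => y [cf df] [cg dg].
  split; first exact: continuousM.
  by move=> i; exact: derivableM.
move=> i.
apply: ck_near (ckD (IH _ _ (ckS F) (K2 i)) (IH _ _ (ckS G) (H2 i))).
apply: filterS2 H1 K1 => y [_ df] [_ dg].
by apply/esym/deriveM.
Qed.

Lemma ck_sum k m (W : normedModType R) (I : Type) (r : seq I)
    (f : I -> 'rV[R]_m -> W) x :
  (forall i, ck k (f i) x) -> ck k (fun y => \sum_(i <- r) f i y) x.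
Proof.
move=> H; elim: r => [|i r IH].
  by apply: ck_near (ck_cst k 0 x); apply: near_all => y; rewrite big_nil.
by apply: ck_near (ckD (H i) IH); apply: near_all => y; rewrite big_cons.
Qed.

Lemma derive_coord m (x v : 'rV[R]_m) j :
  'D_v (fun y : 'rV[R]_m => y 0 j) x = v 0 j.
Proof.
have := @derive_mx R _ _ _ id x v (@derivable_id _ _ x v).
by rewrite derive_id => /matrixP/(_ 0 j); rewrite mxE.
Qed.

Lemma ck_coord k m (x : 'rV[R]_m) j : ck k (fun y : 'rV[R]_m => y 0 j : R) x.
Proof.
case: k => [|k] /=.
  by apply: near_all => y; exact: coord_continuous.
split.
  apply: near_all => y; split; first exact: coord_continuous.
  move=> i; apply/diff_derivable; exact: differentiable_coord.
move=> i; apply: (ck_near _ (ck_cst k ((ebase i : 'rV[R]_m) 0 j) x)).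
by apply: near_all => y; rewrite derive_coord.
Qed.

Lemma continuous_rowP (T : topologicalType) n (f : T -> 'rV[R]_n) (x : T) :
  {for x, continuous f} <->
  forall j, {for x, continuous (fun y => f y 0 j : R)}.
Proof. exact: (@cvg_rowP R n T (nbhs x)). Qed.

Lemma ck_row k m n (f : 'rV[R]_m -> 'rV[R]_n) x :
  ck k f x <-> forall j, ck k (fun y => f y 0 j : R) x.
Proof.
split.
  elim: k f => [|k IH] f /=.
    move=> H j; apply: filterS H => y cf.
    exact: (continuous_rowP _ _).1 cf j.
  move=> [H1 H2] j; split.
    apply: filterS H1 => y [cf df]; split; first exact: (continuous_rowP _ _).1 cf j.
    by move=> i; have /derivable_mxP := df i; exact.
  move=> i; apply: ck_near (IH _ (H2 i) j).
  apply: filterS H1 => y [_ /(_ i) df].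
  by rewrite (derive_mx df) mxE.
elim: k f => [|k IH] f /=.
  move=> H; have {H} := near_forall H.
  by apply: filterS => y cf; apply/continuous_rowP => j; exact: cf.
move=> H.
have H1 : \forall y \near x, {for y, continuous f} /\
       forall i, derivable f y (ebase i).
  have := near_forall (fun j => (H j).1).
  apply: filterS => y cdf; split.
    by apply/continuous_rowP => j; exact: (cdf j).1.
  by move=> i; apply/derivable_mxP => a b; rewrite ord1; exact: (cdf b).2.
split=> // i; apply: IH => j.
apply: ck_near ((H j).2 i).
by apply: filterS H1 => y [_ /(_ i) df]; rewrite (derive_mx df) mxE.
Qed.

Lemma ck_differentiable k m n (f : 'rV[R]_m -> 'rV[R]_n) x :
  ck k.+1 f x -> \forall y \near x, differentiable f y.
Proof.
move=> [H1 H2].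
have H1' : \forall y \near x, \forall z \near y, forall i, derivable f z (ebase i).
  by apply: near_near; apply: filterS H1 => y [].
have H2' : \forall y \near x, forall i, {for y, continuous ('D_(ebase i) f)}.
  by apply: near_forall => i; exact: ck0W (H2 i).
near=> y; apply: C1_differentiable; by near: y.
Unshelve. all: by end_near. Qed.

Lemma derive_sum_basis m (W : normedModType R) (f : 'rV[R]_m -> W) x v :
  differentiable f x -> 'D_v f x = \sum_i v 0 i *: 'D_(ebase i) f x.
Proof.
move=> df; rewrite deriveE// {1}(row_sum_delta v) linear_sum.
by apply: eq_bigr => i _; rewrite linearZ/= deriveE.
Qed.

Lemma derive_comp m n (W : normedModType R) (g : 'rV[R]_n -> W)
    (f : 'rV[R]_m -> 'rV[R]_n) x v :
  differentiable f x -> differentiable g (f x) ->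
  'D_v (g \o f) x = 'D_('D_v f x) g (f x).
Proof.
move=> df dg; rewrite !deriveE//; last exact: differentiable_comp.
by rewrite diff_comp.
Qed.

(** The partial derivatives of [g \o f] are sums of products of those of [f] with
    those of [g] composed with [f], which are of class C^k by induction. *)
Lemma ck_comp k m n p (g : 'rV[R]_n -> 'rV[R]_p) (f : 'rV[R]_m -> 'rV[R]_n) x :
  ck k f x -> ck k g (f x) -> ck k (g \o f) x.
Proof.
elim: k p g => [|k IH] p g F G.
  have /= F' := F; have /= G' := G.
  have cf : {for x, continuous f} := ck_continuous F.
  have Gf := cf _ G'.
  rewrite /=; near=> y.
  apply: continuous_comp; first by near: y.
  by near: y.
have cf : {for x, continuous f} := ck_continuous F.
have df := ck_differentiable F.
have dg := cf _ (ck_differentiable G).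
split.
  near=> y.
  have dgf : differentiable (g \o f) y.
    by apply: differentiable_comp; [near: y|near: y].
  split; first exact: differentiable_continuous.
  by move=> i; exact: diff_derivable.
move=> i.
have E : ck k (fun y => \sum_j ('D_(ebase i) f y) 0 j *: ('D_(ebase j) g \o f) y) x.
  apply: ck_sum => j; apply/ck_row => l.
  have := ckM ((ck_row _ _ _).1 (F.2 i) j) ((ck_row _ _ _).1 (IH _ _ (ckS F) (G.2 j)) l).
  by apply: ck_near; apply: near_all => y; rewrite !mxE.
apply: ck_near E; near=> y.
have dfy : differentiable f y by near: y.
have dgy : differentiable g (f y) by near: y.
by rewrite [RHS](derive_comp _ dfy dgy) [RHS]derive_sum_basis.
Unshelve. all: by end_near. Qed.

End Ck.

(** * Smoothness, flat functions and bump functions *)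

(** The neighborhood on which the derivatives exist may shrink with the order;
    on open sets this makes no difference ([smooth_onP]). *)
Definition smooth_at (R : realType) m (W : normedModType R)
  (f : 'rV[R]_m -> W) (x : 'rV[R]_m) := forall k, ck k f x.

Lemma partial_along_rcons (R : realType) m n (s : seq 'I_m) i
    (f : 'rV[R]_m -> 'rV[R]_n) :
  partial_along (rcons s i) f = partial_along s ('D_(ebase i) f).
Proof. by rewrite /partial_along foldr_rcons. Qed.

(** [partial_along (rcons s i) f] takes the derivative in the direction [i] first,
    so that an induction on [s] from the right meets the recursion of [ck]. *)
Lemma smooth_onP (R : realType) m n (U : set 'rV[R]_m)
    (f : 'rV[R]_m -> 'rV[R]_n) : open U ->
  smooth_on U f <-> forall x, U x -> smooth_at f x.
Proof.
move=> oU; split=> [sf x Ux k|sf s x Ux].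
  have nU : \forall y \near x, U y by exact: open_nbhs_nbhs.
  elim: k f sf => [|k IH] f sf.
    by apply: filterS nU => y /(sf [::])[].
  split; first by apply: filterS nU => y /(sf [::]).
  move=> i; apply: IH => s y Uy.
  by rewrite -partial_along_rcons; exact: sf.
have {Ux} := sf x Ux.
elim/last_ind: s f {sf} => [|s i IH] f sf.
  by have [/nbhs_singleton] := sf 1%N.
rewrite partial_along_rcons; apply: IH => k.
by have [_] := sf k.+1; exact.
Qed.

Lemma near_gt (R : realType) (a b : R) : a < b -> \forall t \near b, a < t.
Proof.
move=> ab; have : - b < - a by rewrite ltrN2.
by move=> /Nlt_nbhsl; apply: filterS => t; rewrite ltrN2.
Qed.

Lemma derivable1_continuous (R : realType) (W : normedModType R) (f : R -> W) t :
  derivable f t 1 -> {for t, continuous f}.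
Proof.
by move=> df; exact/differentiable_continuous/(derivable1_diffP _ _).1.
Qed.

(** A chain rule for one directional derivative, since differentiability of [f] is
    not at hand in inductions on the order. *)
Lemma derive_comp1 (R : realType) (V : normedModType R) (f : V -> R)
    (g : R -> R) (dg : R) x v :
  derivable f x v -> is_derive (f x) (1:R) g dg ->
  derivable (g \o f) x v /\ 'D_v (g \o f) x = dg * 'D_v f x.
Proof.
move=> df [Dg <-].
pose F := fun h : R => f (h *: v + x).
have F0 : F 0 = f x by rewrite /F scale0r add0r.
have dF : derivable F 0 1 := (derivable1P f x v).1 df.
have dgF : derivable (g \o F) 0 1.
  apply: (derivable1_diffP _ _).2; apply: differentiable_comp.
    exact: (derivable1_diffP _ _).1 dF.
  by rewrite F0; exact: (derivable1_diffP _ _).1 Dg.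
split; first exact: ((derivable1P (g \o f) x v).2 dgF).
have E (k : V -> R) : 'D_v k x = derive1 (fun h : R => k (h *: v + x)) 0.
  rewrite derive1E /derive.
  set F1 := (X in lim (X @ _) = _); set F2 := (X in _ = lim (X @ _)).
  suff -> : F1 = F2 by [].
  by apply/funext => h; rewrite /F1 /F2/= scale0r !addr0 add0r [_%:A]mulr1.
rewrite !E.
rewrite -derive1E.
have dg0 : derivable g (F 0) 1 by rewrite F0; exact: Dg.
by have := derive1_comp dF dg0; rewrite F0.
Qed.

Lemma ckV (R : realType) k m (f : 'rV[R]_m -> R) x :
  f x != 0 -> ck k f x -> ck k (fun y => (f y)^-1) x.
Proof.
elim: k => [|k IH] fx0 F.
  have cf := ck_continuous F.
  have fn0 : \forall y \near x, f y != 0 by exact: (cvgr_neq0 _ cf fx0).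
  by apply: filterS2 fn0 F => y fy0 cfy; exact: continuousV.
have cf := ck_continuous F.
have fn0 : \forall y \near x, f y != 0 by exact: (cvgr_neq0 _ cf fx0).
have [H1 H2] := F; split.
  apply: filterS2 fn0 H1 => y fy0 [cfy dfy]; split; first exact: continuousV.
  by move=> i; exact: derivableV.
move=> i; have G := IH fx0 (ckS F).
have := ckM (ck_cst k (-1 : R) x) (ckM (ckM G G) (H2 i)).
apply: ck_near; apply: filterS2 fn0 H1 => y fy0 [cfy dfy].
by rewrite (deriveV fy0 (dfy i)) mulN1r scaleNr -exprVn expr2.
Qed.

(** The derivatives of exp(-1/t), extended by 0 to t <= 0, are linear combinations
    of these functions.  The family being stable under derivation, all its members
    are smooth by induction on the order. *)
Definition flat (R : realType) n (t : R) : R :=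
  if 0 < t then t^-1 ^+ n * expR (- t^-1) else 0.

Section Flat.
Variable R : realType.
Local Notation flat := (@flat R).

Lemma flat_ge0 n t : 0 <= flat n t.
Proof.
by rewrite /flat; case: ifP => // t0; rewrite mulr_ge0 ?expR_ge0// exprn_ge0// invr_ge0 ltW.
Qed.

Lemma flat_gt0 n t : 0 < t -> 0 < flat n t.
Proof.
by move=> t0; rewrite /flat t0 mulr_gt0 ?expR_gt0// exprn_gt0// invr_gt0.
Qed.

Lemma flat_eq0 n t : t <= 0 -> flat n t = 0.
Proof. by rewrite /flat leNgt => /negbTE ->. Qed.

Lemma flat_recl n t : flat n t = t * flat n.+1 t.
Proof.
rewrite /flat; case: ifP => t0; last by rewrite mulr0.
by rewrite exprS mulrA mulrA mulfV ?gt_eqF// mul1r.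
Qed.

(** In terms of x = 1/t this says x^N <= N^N exp x, which follows from
    x/N <= exp(x/N). *)
Lemma flat_bound n t : flat n.+1 t <= n.+1%:R ^+ n.+1.
Proof.
rewrite /flat; case: ifP => [t0|_]; last by rewrite exprn_ge0.
set x := t^-1; have x0 : 0 < x by rewrite invr_gt0.
rewrite expRN ler_pdivrMr ?expR_gt0//.
have -> : expR x = expR (x / n.+1%:R) ^+ n.+1.
  by rewrite -expRM_natl mulrCA mulfV ?mulr1// pnatr_eq0.
rewrite -exprMn ler_pXn2r// ?nnegrE ?mulr_ge0 ?expR_ge0 ?(ltW x0)//.
rewrite -ler_pdivrMl// mulrC (le_trans _ (expR_ge1Dx _))//.
by rewrite lerDr.
Qed.

Lemma flat_le_lin n t : `|flat n t| <= n.+1%:R ^+ n.+1 * `|t|.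
Proof.
by rewrite flat_recl normrM mulrC ler_wpM2r// ger0_norm ?flat_ge0// flat_bound.
Qed.

(** At 0 the difference quotient is [flat n.+1], which is O(t). *)
Lemma is_derive_flat n t :
  is_derive t (1:R) (flat n) (- n%:R * flat n.+1 t + flat n.+2 t).
Proof.
have [t0|t0|->] := ltgtP t 0.
- rewrite !flat_eq0 ?(ltW t0)// mulr0 addr0.
  apply: (near_eq_is_derive (f := cst 0)).
  by apply: filterS (lt_nbhsl t0) => y y0; rewrite flat_eq0// ltW.
- have tn0 : t != 0 by rewrite gt_eqF.
  have dV : is_derive t (1:R) (fun y : R => y^-1) (- t^-1 ^+ 2).
    apply: DeriveDef; first exact: derivableV.
    have H := @deriveV R _ id t 1 tn0 (@derivable_id _ _ t 1).
    by rewrite [LHS]H derive_id [_ *: _]mulr1 exprVn.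
  have dX := is_deriveX n dV.
  have dN : is_derive t (1:R) (fun y : R => - y^-1) (t^-1 ^+ 2).
    by rewrite -[t^-1 ^+ 2]opprK; exact: is_deriveN.
  have dE : is_derive t (1:R) (fun y : R => expR (- y^-1)) (t^-1 ^+ 2 * expR (- t^-1)).
    have [H1 H2] := derive_comp1 (@ex_derive _ _ _ _ _ _ _ dN) (is_derive_expR (- t^-1)).
    apply: DeriveDef => //; by rewrite H2 derive_val mulrC.
  have H := is_deriveM dX dE; rewrite !exprfctE/= in H.
  have nE : \forall y \near t, y^-1 ^+ n * expR (- y^-1) = flat n y.
    by apply: filterS (near_gt t0) => y y0; rewrite /flat y0.
  have H' := near_eq_is_derive nE H.
  apply: is_derive_eq H' _.
  rewrite /flat t0 /GRing.scale/=.
  case: n {dX H nE} => [|n]; first by rewrite !expr0 !expr1 ; ring.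
  rewrite /= !exprS; ring.
- rewrite !flat_eq0// mulr0 addr0.
  suff H : (fun h : R => h^-1 *: (flat n (h *: 1 + 0) - flat n 0)) @ 0^' --> (0 : R).
    by apply: DeriveDef; [apply/cvg_ex; exists 0|exact: cvg_lim].
  have E : (fun h : R => h^-1 *: (flat n (h *: 1 + 0) - flat n 0)) =
           (fun h : R => h^-1 * h * flat n.+1 h).
    apply/funext => h.
    by rewrite [flat n 0]flat_eq0// subr0 addr0 [h *: 1]mulr1 flat_recl [LHS]mulrA.
  rewrite E; apply/cvgrPdist_le => e e0.
  pose C : R := n.+2%:R ^+ n.+2.
  have C0 : 0 < C by rewrite exprn_gt0.
  near=> h.
  have h0 : h != 0 by near: h; exact: nbhs_dnbhs_neq.
  rewrite mulVf// mul1r sub0r normrN (le_trans (flat_le_lin _ _))//.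
  rewrite mulrC -ler_pdivlMr//.
  by near: h; apply: dnbhs0_le; rewrite divr_gt0.
Unshelve. all: by end_near. Qed.


Lemma flat_continuous n : continuous (flat n).
Proof.
move=> t; apply: derivable1_continuous.
exact: (@ex_derive _ _ _ _ _ _ _ (is_derive_flat n t)).
Qed.

Lemma ck_flat k n m (f : 'rV[R]_m -> R) x :
  ck k f x -> ck k (fun y => flat n (f y)) x.
Proof.
elim: k n => [|k IH] n F.
  apply: filterS F => y cf; apply: (continuous_comp cf).
  exact: flat_continuous.
have [H1 H2] := F; split.
  apply: filterS H1 => y [cf df]; split.
    by apply: (continuous_comp cf); exact: flat_continuous.
  by move=> i; exact: (derive_comp1 (df i) (is_derive_flat n (f y))).1.
move=> i.
have A := ckM (ck_cst k (- n%:R : R) x) (IH n.+1 (ckS F)).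
have := ckM (ckD A (IH n.+2 (ckS F))) (H2 i).
apply: ck_near; apply: filterS H1 => y [cf df].
by have [_ ->] := derive_comp1 (df i) (is_derive_flat n (f y)).
Qed.

End Flat.

(** Equal to 1 when t^2 <= 1 and to 0 when t^2 >= 2.  The denominator is positive
    because 2 - t^2 and t^2 - 1 add up to 1. *)
Definition plateau (R : realType) (t : R) : R :=
  flat 0 (2 - t ^+ 2) / (flat 0 (2 - t ^+ 2) + flat 0 (t ^+ 2 - 1)).

Section Plateau.
Variable R : realType.
Local Notation flat := (@flat R).
Local Notation plateau := (@plateau R).

Lemma plateau_den_gt0 (t : R) :
  0 < flat 0 (2 - t ^+ 2) + flat 0 (t ^+ 2 - 1).
Proof.
have [t2|t2] := ltP (t ^+ 2) 2.
  by rewrite ltr_wpDr ?flat_ge0// flat_gt0// subr_gt0.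
rewrite ltr_wpDl ?flat_ge0// flat_gt0// subr_gt0 (lt_le_trans _ t2)//.
by rewrite ltr1n.
Qed.

Lemma plateau_eq1 (t : R) : t ^+ 2 <= 1 -> plateau t = 1.
Proof.
move=> t1; have := plateau_den_gt0 t.
rewrite /plateau [flat 0 (t ^+ 2 - 1)]flat_eq0 ?subr_le0// addr0 => h.
by rewrite divff// gt_eqF.
Qed.

Lemma plateau_eq0 (t : R) : 2 <= t ^+ 2 -> plateau t = 0.
Proof. by move=> t2; rewrite /plateau flat_eq0 ?subr_le0// mul0r. Qed.

Lemma plateau_ge0 (t : R) : 0 <= plateau t.
Proof. by rewrite divr_ge0 ?flat_ge0// ltW// plateau_den_gt0. Qed.

Lemma plateau_le1 (t : R) : plateau t <= 1.
Proof.
by rewrite ler_pdivrMr ?plateau_den_gt0// mul1r lerDl flat_ge0.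
Qed.

Lemma ck_plateau k m (f : 'rV[R]_m -> R) x :
  ck k f x -> ck k (fun y => plateau (f y)) x.
Proof.
move=> F; have F2 : ck k (fun y => f y ^+ 2) x.
  by have := ckM F F; under eq_fun do rewrite -expr2.
have N2 : ck k (fun y => - (f y ^+ 2)) x.
  by have := ckM (ck_cst k (-1 : R) x) F2; under eq_fun do rewrite mulN1r.
have A : ck k (fun y => flat 0 (2 - f y ^+ 2)) x.
  by apply: ck_flat; exact: ckD (ck_cst k (2 : R) x) N2.
have B : ck k (fun y => flat 0 (f y ^+ 2 - 1)) x.
  by apply: ck_flat; exact: ckD F2 (ck_cst k (-1 : R) x).
have d0 : flat 0 (2 - f x ^+ 2) + flat 0 (f x ^+ 2 - 1) != 0.
  by rewrite gt_eqF// plateau_den_gt0.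
exact: ckM A (ckV d0 (ckD A B)).
Qed.

(** Maps R^n smoothly into the open ball of radius [e] and is the identity near 0.
    It makes a displacement short enough to stay inside a chart without changing
    it to first order. *)
Definition squash n (e : R) (w : 'rV[R]_n) : 'rV[R]_n :=
  \row_j (w 0 j * plateau (2 * w 0 j / e)).

Lemma squash_lt n e (w : 'rV[R]_n) : 0 < e -> `|squash e w| < e.
Proof.
move=> e0; apply: row_norm_lt => // j; rewrite mxE.
set t := w 0 j; set s := 2 * t / e.
(* the cutoff forces [s ^+ 2 < 2], hence [`|s| < 2], that is [`|t| < e] *)
have [s2|s2] := leP 2 (s ^+ 2).
  by rewrite plateau_eq0// mulr0 normr0.
rewrite normrM (ger0_norm (plateau_ge0 _)).
apply: (@le_lt_trans _ _ `|t|).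
  by rewrite ler_piMr// plateau_le1.
have -> : t = s * (e / 2) by rewrite /s; field; rewrite gt_eqF.
rewrite normrM (@ger0_norm _ (e / 2)) ?divr_ge0 ?ltW//.
rewrite mulrA ltr_pdivrMr// mulrC ltr_pM2l//.
have [//|s2'] := ltP `|s| 2.
suff : 2 < s ^+ 2 by rewrite ltNge (ltW s2).
rewrite -(real_normK (num_real _)); apply: lt_le_trans (_ : 2 ^+ 2 <= _).
  by rewrite expr2 ltr_pMr// ltr1n.
by rewrite ler_pXn2r// nnegrE.
Qed.

Lemma squash_id n e (w : 'rV[R]_n) : 0 < e -> `|w| <= e / 2 -> squash e w = w.
Proof.
move=> e0 we; apply/rowP => j; rewrite mxE plateau_eq1 ?mulr1//.
rewrite -(real_normK (num_real _)) -[leRHS](expr1n _ 2) ler_pXn2r ?nnegrE//.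
rewrite normrM normfV (gtr0_norm e0) ler_pdivrMr// mul1r normrM ger0_norm//.
rewrite mulrC -ler_pdivlMr//; apply: le_trans we; exact: row_norm_coord.
Qed.

Lemma squash0 n e : 0 < e -> squash e (0 : 'rV[R]_n) = 0.
Proof. by move=> e0; rewrite squash_id// normr0 divr_ge0// ltW. Qed.

Lemma ck_squash k m n e (f : 'rV[R]_m -> 'rV[R]_n) x :
  ck k f x -> ck k (fun y => squash e (f y)) x.
Proof.
move=> /ck_row F; apply/ck_row => j.
under eq_fun do rewrite mxE.
apply: ckM (F j) _; apply: ck_plateau.
exact: ckM (ckM (ck_cst k (2 : R) x) (F j)) (ck_cst k (e^-1) x).
Qed.

(** The open unit cube, where this is positive, is the unit ball of the norm on
    row vectors. *)
Definition cube_bump n (u : 'rV[R]_n) : R := \prod_j flat 0 (1 - u 0 j ^+ 2).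

Lemma cube_bump_ge0 n (u : 'rV[R]_n) : 0 <= cube_bump u.
Proof. by apply: prodr_ge0 => j _; exact: flat_ge0. Qed.

Lemma cube_bump0_gt0 n : 0 < cube_bump (0 : 'rV[R]_n).
Proof.
by apply: prodr_gt0 => j _; rewrite flat_gt0// mxE expr0n/= subr0.
Qed.

Lemma cube_bump_supp n (u : 'rV[R]_n) : cube_bump u != 0 -> `|u| < 1.
Proof.
move=> /prodf_neq0 H; apply: row_norm_lt => // j.
rewrite ltNge; apply/negP => u1; have /(_ isT)/eqP := H j; apply.
rewrite flat_eq0// subr_le0 -(real_normK (num_real _)) -[leLHS](expr1n _ 2).
by rewrite ler_pXn2r// nnegrE.
Qed.

Lemma ck_prod k m (I : Type) (r : seq I) (f : I -> 'rV[R]_m -> R) x :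
  (forall i, ck k (f i) x) -> ck k (fun y => \prod_(i <- r) f i y) x.
Proof.
move=> H; elim: r => [|i r IH].
  by apply: ck_near (ck_cst k (1 : R) x); apply: near_all => y; rewrite big_nil.
by apply: ck_near (ckM (H i) IH); apply: near_all => y; rewrite big_cons.
Qed.

Lemma ck_cube_bump k m n (f : 'rV[R]_m -> 'rV[R]_n) x :
  ck k f x -> ck k (fun y => cube_bump (f y)) x.
Proof.
move=> /ck_row F; apply: ck_prod => j; apply: ck_flat.
have := ckD (ck_cst k (1 : R) x) (ckM (ck_cst k (-1 : R) x) (ckM (F j) (F j))).
by under eq_fun do rewrite mulN1r -expr2.
Qed.

End Plateau.

(** * Charts and smooth maps into a manifold *)

Lemma continuous_near (T U : topologicalType) (f : T -> U) (P : U -> Prop)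
    (x : T) :
  {for x, continuous f} -> (\forall y \near f x, P y) ->
  \forall s \near x, P (f s).
Proof. by move=> cf H; exact: cf. Qed.

Section Charts.
Variable R : realType.

Section LocalHomeo.
Variables (T : topologicalType) (n : nat) (c : chart R T n).
Hypothesis hc : is_local_homeo c.

Lemma chart_open : open (chart_dom c). Proof. by have [] := hc. Qed.

Lemma chart_dom_near x : chart_dom c x -> \forall y \near x, chart_dom c y.
Proof. by move=> cx; apply: open_nbhs_nbhs; split => //; exact: chart_open. Qed.

Lemma chart_inj x y :
  chart_dom c x -> chart_dom c y -> c x = c y -> x = y.
Proof. by have [_ H _ _] := hc => cx cy; apply: H; exact/mem_set. Qed.

Lemma chart_continuous x : chart_dom c x -> {for x, continuous c}.
Proof.
move=> cx; have [_ _ /subspace_continuousP/(_ x cx) H _] := hc.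
move=> A /H; rewrite /within/= => HA.
by apply: filterS2 (chart_dom_near cx) HA => y cy; apply.
Qed.

Lemma chart_image_nbhs x (A : set T) : chart_dom c x -> nbhs x A ->
  nbhs (c x) (c @` (chart_dom c `&` A)).
Proof.
move=> cx; rewrite nbhsE => -[B [oB Bx] BA].
have [_ _ _ /(_ (chart_dom c `&` B)) H] := hc.
have {}H : open (c @` (chart_dom c `&` B)).
  by apply: H; [exact: subIsetl|apply: openI => //; exact: chart_open].
apply: (@filterS _ _ _ (c @` (chart_dom c `&` B))).
  by apply: image_subset => y [cy /BA].
by apply: open_nbhs_nbhs; split => //; exists x.
Qed.

(** A chart maps neighborhoods to neighborhoods and is injective, so that continuity
    can be tested after composing with it. *)
Lemma continuous_of_chart (Z : topologicalType) (f : Z -> T) (z : Z) :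
  chart_dom c (f z) -> (\forall y \near z, chart_dom c (f y)) ->
  {for z, continuous (c \o f)} -> {for z, continuous f}.
Proof.
move=> cz nz cf A /(chart_image_nbhs cz)/cf.
rewrite /= => H; apply: filterS2 nz H => y cy [t [ct At] E].
have tE : t = f y by exact: chart_inj E.
suff : A (f y) by [].
by rewrite -tE.
Qed.

(** The default value [t0] is taken outside the image of the chart. *)
Definition chart_inv (t0 : T) (u : 'rV[R]_n) : T :=
  xget t0 [set y | chart_dom c y /\ c y = u].

Lemma chart_invP t0 u : (c @` chart_dom c) u ->
  chart_dom c (chart_inv t0 u) /\ c (chart_inv t0 u) = u.
Proof.
move=> [y cy yu]; rewrite /chart_inv.
by apply: (@xgetPex _ t0 [set y | chart_dom c y /\ c y = u]); exists y.
Qed.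

Lemma chart_invK t0 y : chart_dom c y -> chart_inv t0 (c y) = y.
Proof.
move=> cy; have [] := @chart_invP t0 (c y); first by exists y.
by move=> ? /chart_inj; apply.
Qed.

Lemma coord_repE (S : topologicalType) m (d : chart R S m) (f : T -> S) y :
  chart_dom c y -> coord_rep c d f (c y) = d (f y).
Proof.
move=> cy; rewrite /coord_rep.
set P := (X in xget _ X).
have [z [cz zy] <-] : P (xget 0 P).
  by apply: xgetPex; exists (d (f y)); exists y.
by rewrite (chart_inj cz cy).
Qed.

Lemma coord_dom_open (S : topologicalType) m (d : chart R S m) (f : T -> S) :
  open (chart_dom d) -> continuous f -> open (coord_dom c d f).
Proof.
move=> od cf; have [_ _ _ H] := hc; apply: H; first exact: subIsetl.
apply: openI; first exact: chart_open.
by apply: open_comp => // x _; exact: cf.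
Qed.

End LocalHomeo.

(** Smoothness near a point of a map into a manifold, read in one chart.  Any other
    chart at that point gives the same notion ([smooth_into_chart]). *)
Definition smooth_into (M : mfd R) m (f : 'rV[R]_m -> M) (t : 'rV[R]_m) : Prop :=
  (\forall s \near t, {for s, continuous f}) /\
  exists2 c, charts_at (f t) c & smooth_at (c \o f) t.

Lemma smooth_at_near m (W : normedModType R) (f g : 'rV[R]_m -> W) x :
  (\forall y \near x, f y = g y) -> smooth_at f x -> smooth_at g x.
Proof. by move=> fg sf k; exact: ck_near fg (sf k). Qed.

Lemma smooth_at_comp m n p (g : 'rV[R]_n -> 'rV[R]_p)
    (f : 'rV[R]_m -> 'rV[R]_n) x :
  smooth_at f x -> smooth_at g (f x) -> smooth_at (g \o f) x.
Proof. by move=> sf sg k; exact: ck_comp. Qed.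

Lemma smooth_into_continuous (M : mfd R) m (f : 'rV[R]_m -> M) t :
  smooth_into f t -> {for t, continuous f}.
Proof. by move=> [/nbhs_singleton]. Qed.

Lemma smooth_into_near (M : mfd R) m (f g : 'rV[R]_m -> M) t :
  (\forall s \near t, f s = g s) -> smooth_into f t -> smooth_into g t.
Proof.
move=> fg [cf [c cft sf]]; split.
  by apply: filterS2 cf (near_near fg) => s cfs fgs; exact: near_eq_continuous cfs.
have E : f t = g t := nbhs_singleton fg.
exists c; first by rewrite -E.
by apply: smooth_at_near sf; apply: filterS fg => s /= ->.
Qed.

Section Smooth.
Variables (M N : mfd R).
Hypotheses (hM : is_manifold M) (hN : is_manifold N).

Lemma atlas_homeo (c : chart R M (mfd_dim M)) : atlas c -> is_local_homeo c.
Proof. by have [_ _ _ H _] := hM; exact: H. Qed.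

Lemma charts_homeo (x : M) c : charts_at x c -> is_local_homeo c.
Proof. by move=> [/atlas_homeo]. Qed.

Lemma charts_ex (x : M) : exists c, charts_at x c.
Proof. by have [_ _ H _ _] := hM; exact: H. Qed.

End Smooth.
End Charts.

Section Smooth2.
Variables (R : realType) (M N : mfd R).
Hypotheses (hM : is_manifold M) (hN : is_manifold N).

Lemma smooth_map_id : smooth_map (id : M -> M).
Proof.
split; first by move=> x; exact: cvg_id.
by have [_ _ _ _ H] := hM; exact: H.
Qed.

Lemma coord_rep_smooth (f : M -> N) x c d : smooth_map f ->
  charts_at x c -> charts_at (f x) d -> smooth_at (coord_rep c d f) (c x).
Proof.
move=> [cf sf] [ac cx] [ad dfx].
have hc := atlas_homeo hM ac; have hd := atlas_homeo hN ad.
have := sf c d ac ad; rewrite smooth_onP.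
  by apply; exists x.
by apply: coord_dom_open => //; exact: chart_open.
Qed.

Lemma smooth_into_comp_chart (f : M -> N) m (p : 'rV[R]_m -> M) t d :
  smooth_map f -> smooth_into p t -> charts_at (f (p t)) d ->
  smooth_at (d \o f \o p) t.
Proof.
move=> sf mp dfp; have cp := smooth_into_continuous mp.
have [_ [c cpt scp]] := mp.
have hc := charts_homeo hM cpt.
have := smooth_at_comp scp (coord_rep_smooth sf cpt dfp).
apply: smooth_at_near.
apply: filterS (continuous_near cp (chart_dom_near hc cpt.2)) => s cs.
by rewrite /= coord_repE.
Qed.

Lemma smooth_into_comp (f : M -> N) m (p : 'rV[R]_m -> M) t :
  smooth_map f -> smooth_into p t -> smooth_into (f \o p) t.
Proof.
move=> sf mp; have [cp _] := mp.
split.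
  by apply: filterS cp => s cs; apply: (continuous_comp cs); exact: sf.1.
have [d dft] := charts_ex hN (f (p t)).
by exists d => //; exact: smooth_into_comp_chart.
Qed.

End Smooth2.

Section Smooth3.
Variables (R : realType) (M : mfd R).
Hypotheses (hM : is_manifold M).

Lemma smooth_into_chart m (p : 'rV[R]_m -> M) t d :
  smooth_into p t -> charts_at (p t) d -> smooth_at (d \o p) t.
Proof. exact: (smooth_into_comp_chart hM hM (smooth_map_id hM)). Qed.

Lemma euclidean_chartE m (T : topologicalType) n (d : chart R T n)
    (f : 'rV[R]_m -> T) :
  coord_rep (Chart setT id : chart R 'rV[R]_m m) d f = d \o f.
Proof.
apply/funext => u; rewrite /coord_rep; set P := (X in xget _ X).
have [y [_ /= <-] <- //] : P (xget 0 P).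
by apply: xgetPex; exists (d (f u)); exists u.
Qed.

Lemma smooth_map_euclidean m (f : 'rV[R]_m -> M) :
  smooth_map (f : euclidean R m -> M) <-> forall t, smooth_into f t.
Proof.
split=> [[cf sf] t|mf].
  split; first by apply: near_all => s; exact: cf.
  have [d dft] := charts_ex hM (f t).
  exists d => //.
  have := sf _ d (erefl _) dft.1; rewrite euclidean_chartE smooth_onP.
    by apply; exists t => //; split=> //; exact: dft.2.
  rewrite /coord_dom/= image_id setTI.
  apply: open_comp; first by move=> x _; exact: cf.
  by apply: chart_open; exact: charts_homeo dft.
have cf : continuous f by move=> t; exact: smooth_into_continuous (mf t).
split=> // c d -> ad; rewrite euclidean_chartE smooth_onP.
  by move=> _ [t [_ dt] <-] /=; apply: smooth_into_chart.
rewrite /coord_dom/= image_id setTI.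
apply: open_comp; first by move=> x _; exact: cf.
by apply: chart_open; exact: atlas_homeo ad.
Qed.

Lemma smooth_into_pre m k (p : 'rV[R]_k -> M) (g : 'rV[R]_m -> 'rV[R]_k) t :
  smooth_at g t -> smooth_into p (g t) -> smooth_into (p \o g) t.
Proof.
move=> sg [cp [c cpt sp]]; split.
  have cg : \forall s \near t, {for s, continuous g} := sg 0%N.
  have H := continuous_near (nbhs_singleton cg) cp.
  by apply: filterS2 cg H => s; exact: continuous_comp.
by exists c => //; exact: smooth_at_comp sp.
Qed.

(** Once [f] stays in the domain of [c], its continuity follows from that of
    [c \o f]. *)
Lemma smooth_into_intro m (f : 'rV[R]_m -> M) t c : charts_at (f t) c ->
  (\forall s \near t, chart_dom c (f s)) -> smooth_at (c \o f) t -> smooth_into f t.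
Proof.
move=> cft nf sf; split; last by exists c.
have C : \forall s \near t, {for s, continuous (c \o f)} := sf 0%N.
apply: filterS2 (near_near nf) C => s ns.
by apply: continuous_of_chart => //; [exact: charts_homeo cft|exact: nbhs_singleton ns].
Qed.

End Smooth3.

(** * Countable bases, and regularity of manifolds *)

(** Countable bases in the form of sequences, in which empty sets are harmless. *)
Definition seq_basis (T : topologicalType) (e : nat -> set T) : Prop :=
  (forall n, open (e n)) /\
  forall (x : T) A, nbhs x A -> exists2 n, e n x & e n `<=` A.

Lemma second_countableP (T : topologicalType) :
  @second_countable T <-> exists e : nat -> set T, seq_basis e.
Proof.
split=> [[B cB [oB bB]]|[e [oe be]]].
  have /countable_injP[f finj] := cB.
  exists (fun n => \bigcup_(b in [set b | B b /\ f b = n]) b); split=> [n|x A /bB].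
    by apply: bigcup_open => b [/oB].
  move=> [b [Bb bx] bA]; exists (f b); first by exists b.
  move=> y [b' [Bb' fb'] b'y]; apply: bA.
  by have <- : b' = b by apply: finj => //; exact/mem_set.
exists (range e); first by apply: card_le_trans (card_image_le _ _) _; exact: countableP.
split=> [_ [n _ <-]//|x A /be[n enx enA]].
by exists (e n) => //; split=> //; exists n.
Qed.

(** Each basic open set contained in some [U i] selects one such [i]; [None] stands
    for the other ones. *)
Lemma lindelof (T : topologicalType) (I : Type) (U : I -> set T) :
  @second_countable T -> (forall x : T, exists i, nbhs x (U i)) ->
  exists g : nat -> option I, forall x, exists n i, g n = Some i /\ U i x.
Proof.
move=> /second_countableP[e [oe be]] cov.
have /choice[g gP] : forall n, exists o : option I,
    (exists i, e n `<=` U i) -> exists2 i, o = Some i & e n `<=` U i.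
  move=> n; have [[i ei]|nex] := pselect (exists i, e n `<=` U i).
    by exists (Some i) => _; exists i.
  by exists None => /nex.
exists g => x; have [i /be[n enx enU]] := cov x.
have [|j gj ej] := gP n; first by exists i.
by exists n, j; split => //; exact: ej.
Qed.

Lemma ratr_dense_row (R : realType) n (x : 'rV[R]_n) (e : R) : 0 < e ->
  exists q : 'rV[rat]_n, `|x - map_mx ratr q| < e.
Proof.
move=> e0.
have /choice[q qP] : forall j, exists q : rat, `|x 0 j - ratr q| < e.
  move=> j; have [|q] := @rat_in_itvoo R (x 0 j - e) (x 0 j + e).
    by rewrite ltrBlDr -addrA ltrDl addr_gt0.
  rewrite in_itv/= => /andP[q1 q2]; exists q.
  by rewrite ltr_norml; apply/andP; split; lra.
exists (\row_j q j); apply: row_norm_lt => // j.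
by rewrite !mxE; exact: qP.
Qed.

Lemma second_countable_row (R : realType) n : @second_countable 'rV[R]_n.
Proof.
pose b (qk : 'rV[rat]_n * nat) : set 'rV[R]_n :=
  ball (map_mx ratr qk.1 : 'rV[R]_n) (qk.2.+1%:R^-1).
exists (range b).
  by apply: card_le_trans (card_image_le _ _) _; exact: countableP.
split=> [_ [qk _ <-]|x A /nbhs_ballP[e /= e0 xA]].
  by apply: ball_open; rewrite invr_gt0.
have [k ke] : exists k, k.+1%:R^-1 < e / 2 :> R.
  have e20 : 0 < e / 2 by rewrite divr_gt0.
  have [N _ /(_ N (leqnn _)) H] := near_infty_natSinv_lt (PosNum e20).
  by exists N.
have k0 : 0 < k.+1%:R^-1 :> R by rewrite invr_gt0.
have [q qx] := ratr_dense_row x k0.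
exists (b (q, k)).
  by split; [exists (q, k)|rewrite /b -ball_normE/= distrC].
move=> y; rewrite /b -ball_normE/= => yq; apply: xA; rewrite -ball_normE/=.
rewrite -(subrKA (map_mx ratr q)) (le_lt_trans (ler_normD _ _))//.
by rewrite (splitr e) ltrD// (lt_trans _ ke).
Qed.

Section Regularity.
Variables (R : realType) (M : mfd R).
Hypothesis hM : is_manifold M.

Lemma chart_inv_continuous (c : chart R M (mfd_dim M)) (t0 : M) u :
  is_local_homeo c -> (c @` chart_dom c) u ->
  {for u, continuous (chart_inv c t0)}.
Proof.
move=> hc [x cx <-] A; rewrite chart_invK// => /(chart_image_nbhs hc cx).
by apply: filterS => _ [y [cy Ay] <-]; rewrite /= chart_invK.
Qed.

(** A small closed ball of R^n is compact, hence so is its preimage by the chart,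
    which is therefore closed in the Hausdorff space [M].  This is what makes
    extension by zero outside a chart continuous. *)
Lemma chart_ball (x : M) c (O : set M) : charts_at x c -> nbhs x O ->
  exists2 e : R, 0 < e & forall e', 0 < e' -> e' <= e ->
    (forall u, `|u - c x| <= e' -> (c @` (chart_dom c `&` O)) u) /\
    closed (chart_dom c `&` [set y | `|c y - c x| <= e']).
Proof.
move=> ccx xO; have hc := charts_homeo hM ccx.
have /nbhs_ballP[e0 /= e00 He] := chart_image_nbhs hc ccx.2 xO.
have e20 : 0 < e0 / 2 by rewrite divr_gt0.
exists (e0 / 2) => // e e1 ee0.
have H u : `|u - c x| <= e -> (c @` (chart_dom c `&` O)) u.
  move=> ue; apply: He; rewrite -ball_normE/= distrC (le_lt_trans ue)//.
  by rewrite (le_lt_trans ee0)// ltr_pdivrMr// ltr_pMr// ltr1n.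
split=> //.
pose K : set 'rV[R]_(mfd_dim M) := [set u | `|u - c x| <= e].
have Kc : compact K.
  apply: bounded_closed_compact.
    exists (`|c x| + e); split; first exact: num_real.
    move=> r rx u /= uK; rewrite -(subrK (c x) u) (le_trans (ler_normD _ _))//.
    by rewrite ltW// (le_lt_trans _ rx)// addrC lerD2l.
  have -> : K = closed_ball (c x) (e).
    by rewrite closed_ballE//; apply/seteqP; split=> u; rewrite /K/closed_ball_/= distrC.
  exact: closed_ball_closed.
have -> : chart_dom c `&` [set y | `|c y - c x| <= e] = chart_inv c x @` K.
  apply/seteqP; split=> [y [cy yK]|_ [u uK <-]].
    by exists (c y) => //; rewrite chart_invK.
  have [|cu E] := @chart_invP _ _ _ c x u.
    by have [y [cy _] <-] := H _ uK; exists y.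
  by split=> //=; rewrite E.
apply: compact_closed; first by have [] := hM.
apply: continuous_compact => //.
apply/continuous_in_subspaceT => u /set_mem uK; apply: chart_inv_continuous => //.
by have [y [cy _] <-] := H _ uK; exists y.
Qed.

Lemma manifold_regular (x : M) (O : set M) : nbhs x O ->
  exists2 V : set M, nbhs x V & closed V /\ V `<=` O.
Proof.
move=> xO; have [c cx] := charts_ex hM x.
have hc := charts_homeo hM cx.
have [e e0 /(_ e e0 (lexx e))[H1 H2]] := chart_ball cx xO.
eexists; last split; [|exact: H2|].
  have := chart_continuous hc cx.2.
  move=> /cvgrPdistC_le/(_ e e0) H3.
  by apply: filterS2 (chart_dom_near hc cx.2) H3.
move=> y [cy /H1[z [cz Oz]]].
by move=> /(chart_inj hc cz cy) <-.
Qed.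

End Regularity.

(** * Tangent vectors and changes of charts *)

Lemma smooth_at_differentiable (R : realType) m n (f : 'rV[R]_m -> 'rV[R]_n) x :
  smooth_at f x -> differentiable f x.
Proof. by move=> /(_ 1%N)/ck_differentiable/nbhs_singleton. Qed.

Lemma smooth_at_row (R : realType) k m n (f : 'rV[R]_k -> 'rV[R]_m)
    (g : 'rV[R]_k -> 'rV[R]_n) x :
  smooth_at f x -> smooth_at g x -> smooth_at (fun y => row_mx (f y) (g y)) x.
Proof.
move=> sf sg d; apply/ck_row => j.
case: (splitP j) => i ij.
  have -> : j = lshift n i by exact/val_inj.
  by under eq_fun do rewrite row_mxEl; exact: (ck_row _ _ _).1 (sf d) i.
have -> : j = rshift m i by exact/val_inj.
by under eq_fun do rewrite row_mxEr; exact: (ck_row _ _ _).1 (sg d) i.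
Qed.

Lemma smooth_at_lsubmx (R : realType) m n (x : 'rV[R]_(m + n)) :
  smooth_at (lsubmx : 'rV[R]_(m + n) -> 'rV[R]_m) x.
Proof.
move=> k; apply/ck_row => j; under eq_fun do rewrite mxE; exact: ck_coord.
Qed.

Lemma smooth_at_rsubmx (R : realType) m n (x : 'rV[R]_(m + n)) :
  smooth_at (rsubmx : 'rV[R]_(m + n) -> 'rV[R]_n) x.
Proof.
move=> k; apply/ck_row => j; under eq_fun do rewrite mxE; exact: ck_coord.
Qed.

Lemma smooth_at_derive (R : realType) m (W : normedModType R)
    (f : 'rV[R]_m -> W) i x : smooth_at f x -> smooth_at ('D_(ebase i) f) x.
Proof. by move=> sf k; have [_ /(_ i)] := sf k.+1. Qed.

(** The tangent map of [f] in coordinates: [(u, v) |-> (f u, df_u v)]. *)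
Definition tangent_rep (R : realType) m n (f : 'rV[R]_m -> 'rV[R]_n)
    (w : 'rV[R]_(m + m)) : 'rV[R]_(n + n) :=
  row_mx (f (lsubmx w)) ('D_(rsubmx w) f (lsubmx w)).

(** The differential at [u] applied to [v] is the sum of [v_i] times the [i]-th
    partial derivative at [u], in which both factors depend smoothly on [(u, v)]. *)
Lemma smooth_at_tangent_rep (R : realType) m n (f : 'rV[R]_m -> 'rV[R]_n) w :
  smooth_at f (lsubmx w) -> smooth_at (tangent_rep f) w.
Proof.
move=> sf; apply: smooth_at_row.
  have H := smooth_at_comp (@smooth_at_lsubmx R m m w) sf.
  exact: H.
have E : smooth_at (fun w : 'rV[R]_(m + m) =>
    \sum_i (rsubmx w) 0 i *: ('D_(ebase i) f \o lsubmx) w) w.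
  move=> k; apply: ck_sum => i; apply/ck_row => j.
  have A := (ck_row _ _ _).1 (@smooth_at_rsubmx R m m w k) i.
  have B := smooth_at_comp (@smooth_at_lsubmx _ _ _ w) (smooth_at_derive i sf).
  have := ckM A ((ck_row _ _ _).1 (B k) j).
  by apply: ck_near; apply: near_all => y; rewrite !mxE.
apply: smooth_at_near E.
have cl : {for w, continuous (lsubmx : 'rV[R]_(m + m) -> 'rV[R]_m)}.
  exact: (ck_continuous (@smooth_at_lsubmx R m m w 0%N)).
apply: filterS (continuous_near cl (ck_differentiable (sf 1%N))) => y dy.
by rewrite [RHS]derive_sum_basis.
Qed.

Section CoordRep.
Variables (R : realType).

Lemma coord_rep_comp (M N P : mfd R) (f : M -> N) (g : N -> P) x c d
    (e : chart R P (mfd_dim P)) :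
  is_manifold M -> is_manifold N -> continuous f ->
  charts_at x c -> charts_at (f x) d ->
  \forall u \near c x,
    coord_rep c e (g \o f) u = (coord_rep d e g \o coord_rep c d f) u.
Proof.
move=> hM hN cf cx dfx; have hc := charts_homeo hM cx.
have hd := charts_homeo hN dfx.
have nd : \forall y \near x, chart_dom d (f y).
  by apply: continuous_near; [exact: cf|exact: chart_dom_near dfx.2].
apply: filterS (chart_image_nbhs hc cx.2 nd) => _ [y [cy dy] <-].
by rewrite /= !coord_repE.
Qed.

Lemma coord_rep_id (M : mfd R) (x : M) c : is_manifold M -> charts_at x c ->
  \forall u \near c x, coord_rep c c (id : M -> M) u = u.
Proof.
move=> hM cx; have hc := charts_homeo hM cx.
apply: filterS (chart_image_nbhs hc cx.2 (chart_dom_near hc cx.2)) => _ [y [cy _] <-].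
by rewrite coord_repE.
Qed.

Lemma derive_coord_rep_comp (M N P : mfd R) (f : M -> N) (g : N -> P) x c d e v :
  is_manifold M -> is_manifold N -> is_manifold P ->
  smooth_map f -> smooth_map g ->
  charts_at x c -> charts_at (f x) d -> charts_at (g (f x)) e ->
  'D_v (coord_rep c e (g \o f)) (c x) =
  'D_('D_v (coord_rep c d f) (c x)) (coord_rep d e g) (d (f x)).
Proof.
move=> hM hN hP sf sg cx dx ex; have hc := charts_homeo hM cx.
rewrite (near_eq_derive _ (coord_rep_comp _ _ hM hN sf.1 cx dx)).
have df : differentiable (coord_rep c d f) (c x).
  exact/smooth_at_differentiable/coord_rep_smooth.
have E : coord_rep c d f (c x) = d (f x) by rewrite coord_repE//; exact: cx.2.
have dg : differentiable (coord_rep d e g) (coord_rep c d f (c x)).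
  by rewrite E; exact/smooth_at_differentiable/coord_rep_smooth.
by rewrite [LHS](derive_comp _ df dg) E.
Qed.

End CoordRep.

Section TVec.
Variables (R : realType) (M : mfd R).
Hypothesis hM : is_manifold M.

(** The cocycle rule for the differentials of changes of charts, from the chain
    rule. *)
Lemma derive_transition (x : M) c d e v :
  charts_at x c -> charts_at x d -> charts_at x e ->
  'D_v (coord_rep c e id) (c x) =
  'D_('D_v (coord_rep c d id) (c x)) (coord_rep d e id) (d x).
Proof.
have sid := smooth_map_id hM.
exact: (@derive_coord_rep_comp R M M M id id x c d e v hM hM hM sid sid).
Qed.

Lemma derive_transition_id (x : M) c v : charts_at x c ->
  'D_v (coord_rep c c id) (c x) = v.
Proof.
by move=> cx; rewrite (near_eq_derive _ (coord_rep_id hM cx)) derive_id.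
Qed.

(** The components in the other charts are prescribed by the changes of charts; the
    cocycle rule makes them compatible. *)
Lemma tvec_ex (x : M) c v : charts_at x c ->
  exists p : tvec M, tbase p = x /\ tcomp p c = v.
Proof.
move=> cx.
pose comp d := if `[< charts_at x d >] then 'D_v (coord_rep c d id) (c x) else 0.
have H1 d e : charts_at x d -> charts_at x e ->
    comp e = 'D_(comp d) (coord_rep d e id) (d x).
  move=> dx ex; rewrite /comp !ifT; [|exact/asboolP|exact/asboolP].
  exact: derive_transition.
have H2 d : ~ charts_at x d -> comp d = 0.
  by move=> dx; rewrite /comp ifF//; exact/asboolPn.
exists (@Tvec R M x comp H1 H2); split=> //=.
by rewrite /comp ifT ?derive_transition_id//; exact/asboolP.
Qed.

Lemma tvec_eq (p q : tvec M) c : charts_at (tbase p) c ->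
  tbase p = tbase q -> tcomp p c = tcomp q c -> p = q.
Proof.
case: p q => [x a a1 a2] [y b b1 b2]/= cx xy; subst y => ab.
have {}ab : a = b.
  apply/funext => d; have [dx|dx] := pselect (charts_at x d).
    by rewrite (a1 _ _ cx dx) (b1 _ _ cx dx) ab.
  by rewrite a2// b2.
by subst b; congr Tvec; exact: Prop_irrelevance.
Qed.

(** Near 0 the curve [d \o f \o g] is [coord_rep c d f] composed with [c \o g]. *)
Lemma derive_curve (N : mfd R) (f : M -> N) (g : R -> M) c d :
  is_manifold N -> smooth_map f ->
  {for 0, continuous g} -> charts_at (g 0) c -> charts_at (f (g 0)) d ->
  derivable (c \o g) 0 1 ->
  derivable (d \o (f \o g)) 0 1 /\
  'D_1 (d \o (f \o g)) 0 = 'D_('D_1 (c \o g) 0) (coord_rep c d f) (c (g 0)).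
Proof.
move=> hN sf cg cx dx dcg; have hc := charts_homeo hM cx.
have E : \forall t \near (0 : R), (coord_rep c d f \o (c \o g)) t = (d \o (f \o g)) t.
  apply: filterS (continuous_near cg (chart_dom_near hc cx.2)) => t ct.
  by rewrite /= coord_repE.
have df : differentiable (coord_rep c d f) ((c \o g) 0).
  exact/smooth_at_differentiable/coord_rep_smooth.
have dg : differentiable (c \o g) 0 by exact: (derivable1_diffP _ _).1.
split.
  apply: near_eq_derivable E _.
  by apply: (derivable1_diffP _ _).2; exact: differentiable_comp.
rewrite -(near_eq_derive _ E) deriveE; last exact: differentiable_comp.
by rewrite diff_comp//= -!deriveE.
Qed.

End TVec.

(** * The tangent bundle is a manifold *)

Section TangentTopology.
Variables (R : realType) (M : mfd R).

Lemma tangent_subbase_open (c : chart R M (mfd_dim M))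
    (O : set 'rV[R]_(mfd_dim M + mfd_dim M)) :
  atlas c -> open O ->
  open [set p : tvec M | chart_dom c (tbase p) /\ O (tchart c p)].
Proof.
move=> ac oO; set W := [set p | _].
exists [set W]; last by rewrite bigcup_set1.
by move=> _ ->; apply: (@finI_from1 _ _ _ id); exists c, O.
Qed.

(** Convergence to a point can be tested on the subbasic sets, because a filter is
    stable under finite intersections. *)
Lemma cvg_tangent (F : set_system (tvec M)) (p : tvec M) : Filter F ->
  (forall c O, atlas c -> open O -> chart_dom c (tbase p) -> O (tchart c p) ->
     F [set q : tvec M | chart_dom c (tbase q) /\ O (tchart c q)]) ->
  F --> p.
Proof.
move=> FF Fb V; rewrite nbhsE => -[B [[D' D'D <-] [A DA Ap]] BV].
apply: (@filterS _ F _ A); first by apply: subset_trans BV => q Aq; exists A.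
have [K KD KA] := D'D _ DA; rewrite -KA; rewrite -KA in Ap.
apply: filter_bigI => W WK.
have [c [U [ac oU WcU]]] : tvec_subbase W by have := KD _ WK; rewrite inE.
have Wp : W p by apply: Ap.
by rewrite WcU; apply: Fb => //; move: Wp; rewrite WcU => -[].
Qed.

End TangentTopology.

Section TangentManifold.
Variables (R : realType) (M : mfd R).
Hypothesis hM : is_manifold M.
Local Notation TM := (tangent_bundle M).
Local Notation n := (mfd_dim M).

(** The charts of [tangent_bundle M]. *)
Definition lift_chart (c : chart R M n) : chart R (tvec M) (n + n) :=
  Chart [set p : tvec M | chart_dom c (tbase p)] (tchart c).

Lemma lift_chart_inj c (p q : tvec M) : atlas c ->
  chart_dom c (tbase p) -> chart_dom c (tbase q) ->
  tchart c p = tchart c q -> p = q.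
Proof.
move=> ac cp cq /eq_row_mx[E1 E2].
apply: (@tvec_eq R M p q c) => //.
exact: (chart_inj (atlas_homeo hM ac)).
Qed.

Lemma lift_chart_image c w : atlas c ->
  (tchart c @` [set p : tvec M | chart_dom c (tbase p)]) w <->
  (c @` chart_dom c) (lsubmx w).
Proof.
move=> ac; split=> [[p cp <-]|[x cx E]].
  by exists (tbase p) => //; rewrite row_mxKl.
have [p [px pc]] := tvec_ex hM (rsubmx w) (conj ac cx).
exists p; first by rewrite /= px.
by rewrite /tchart px pc E hsubmxK.
Qed.

Lemma tchart_transition c d (p : tvec M) : atlas c -> atlas d ->
  chart_dom c (tbase p) -> chart_dom d (tbase p) ->
  tchart d p = tangent_rep (coord_rep c d id) (tchart c p).
Proof.
move=> ac ad cp dp; have hc := atlas_homeo hM ac.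
rewrite /tangent_rep row_mxKl row_mxKr coord_repE// /tchart.
by rewrite (@tcomp_change _ _ p c d).
Qed.

Lemma smooth_at_lift_transition c d (p : tvec M) : atlas c -> atlas d ->
  chart_dom c (tbase p) -> chart_dom d (tbase p) ->
  smooth_at (tangent_rep (coord_rep c d (id : M -> M))) (tchart c p).
Proof.
move=> ac ad cp dp; apply: smooth_at_tangent_rep; rewrite row_mxKl.
have sid := smooth_map_id hM.
exact: (@coord_rep_smooth R M M hM hM id (tbase p) c d sid (conj ac cp) (conj ad dp)).
Qed.

(** The inverse of a lifted chart is continuous.  The sets whose preimage by this
    inverse is a neighborhood form a filter, since the chart is injective; on
    subbasic sets one uses that changes of lifted charts are continuous. *)
Lemma lift_chart_inv_cvg c (p : tvec M) (V : set (tvec M)) : atlas c ->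
  chart_dom c (tbase p) -> nbhs p V ->
  \forall w \near tchart c p,
    exists2 q : tvec M, chart_dom c (tbase q) /\ V q & tchart c q = w.
Proof.
move=> ac cp; have hc := atlas_homeo hM ac.
pose F : set_system (tvec M) := [set V | \forall w \near tchart c p,
    exists2 q : tvec M, chart_dom c (tbase q) /\ V q & tchart c q = w].
suff : F --> p by move=> /(_ V).
have lc : {for tchart c p, continuous (lsubmx : 'rV[R]_(n + n) -> 'rV[R]_n)}.
  exact: (ck_continuous (@smooth_at_lsubmx R n n _ 0%N)).
have lE : lsubmx (tchart c p) = c (tbase p) by rewrite row_mxKl.
have near_dom (A : set M) : nbhs (tbase p) A ->
    \forall w \near tchart c p, (c @` (chart_dom c `&` A)) (lsubmx w).
  by move=> xA; apply: (continuous_near lc); rewrite lE; exact: chart_image_nbhs.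
apply: cvg_tangent.
  constructor.
  - rewrite /F/=; apply: filterS (near_dom _ (chart_dom_near hc cp)) => w [x [cx _] xw].
    have [|q cq qw] := (lift_chart_image w ac).2; first by exists x.
    by exists q.
  - rewrite /F => A B /= FA FB; apply: filterS2 FA FB => w [q [cq Aq] qw] [q' [cq' Bq'] qw'].
    have E : q = q' by apply: (lift_chart_inj ac) => //; rewrite qw qw'.
    by exists q => //; split=> //; split=> //; rewrite E.
  - rewrite /F => A B AB /=; apply: filterS => w [q [cq Aq] qw].
    by exists q => //; split=> //; exact: AB.
move=> d O ad oO dp Op.
have S := smooth_at_lift_transition ac ad cp dp.
have NO : \forall w \near tchart c p, O (tangent_rep (coord_rep c d id) w).
  apply: (continuous_near (ck_continuous (S 0%N))).
  rewrite -tchart_transition//; exact: open_nbhs_nbhs.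
apply: filterS2 NO (near_dom _ (chart_dom_near (atlas_homeo hM ad) dp)) => w Ow [x [cx dx] xw].
have [|q cq qw] := (lift_chart_image w ac).2; first by exists x.
have qx : tbase q = x.
  by apply: (chart_inj hc) => //; rewrite xw -qw row_mxKl.
have dq : chart_dom d (tbase q) by rewrite qx.
exists q => //; split => //; split=> //.
suff : O (tchart d q) by [].
by rewrite (tchart_transition ac ad cq dq) qw.
Qed.

Lemma lift_chart_homeo c : atlas c -> is_local_homeo (lift_chart c).
Proof.
move=> ac; split.
- rewrite /= (_ : [set p | _] = [set p : tvec M | chart_dom c (tbase p) /\ setT (tchart c p)]).
    by apply: tangent_subbase_open => //; exact: openT.
  by apply/seteqP; split=> p /=; [split|case].
- by move=> p q /set_mem cp /set_mem cq; exact: lift_chart_inj.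
- apply/continuous_in_subspaceT => p /set_mem cp A; rewrite nbhsE => -[U [oU Up] UA].
  have := tangent_subbase_open ac oU; move=> oW.
  have : nbhs p [set p : tvec M | chart_dom c (tbase p) /\ U (tchart c p)].
    by apply: open_nbhs_nbhs.
  by apply: filterS => q [_ /UA].
- move=> V Vc oV; rewrite openE => _ [p Vp <-].
  have pV : nbhs p V by exact: open_nbhs_nbhs.
  rewrite /interior.
  apply: filterS (lift_chart_inv_cvg ac (Vc _ Vp) pV) => w [q [_ Vq] qw].
  by exists q.
Qed.

Lemma tbase_continuous : continuous (@tbase R M).
Proof.
move=> p A pA; have [c cp] := charts_ex hM (tbase p).
have hc := charts_homeo hM cp.
have : nbhs (c (tbase p)) (c @` (chart_dom c `&` A)) by exact: (chart_image_nbhs hc cp.2).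
rewrite nbhsE => -[U [oU Up] UA].
have lc : continuous (lsubmx : 'rV[R]_(n + n) -> 'rV[R]_n).
  by move=> w; exact: (ck_continuous (@smooth_at_lsubmx R n n w 0%N)).
have oU' : open (lsubmx @^-1` U : set 'rV[R]_(n + n)).
  by apply: open_comp => // w _; exact: lc.
have pW : nbhs p [set q : tvec M | chart_dom c (tbase q) /\ (lsubmx @^-1` U) (tchart c q)].
  apply: open_nbhs_nbhs; split; first exact: (tangent_subbase_open cp.1 oU').
  by split; [exact: cp.2|rewrite /= row_mxKl].
apply: filterS pW => q [cq]; rewrite /= row_mxKl => /UA[x [cx Ax] /(chart_inj hc cx cq) <-].
exact: Ax.
Qed.

Lemma countable_atlas : exists g : nat -> option (chart R M n),
  (forall i c, g i = Some c -> atlas c) /\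
  forall x, exists i c, g i = Some c /\ charts_at x c.
Proof.
have [_ sM cov _ _] := hM.
have [|g gP] := @lindelof M {c : chart R M n | atlas c}
   (fun c => chart_dom (sval c)) sM.
  move=> x; have [c cx] := charts_ex hM x.
  exists (exist _ c cx.1) => /=.
  exact: (chart_dom_near (charts_homeo hM cx) cx.2).
exists (fun i => omap (@sval _ _) (g i)); split=> [i c|x].
  by case: (g i) => //= -[d ad] [<-].
have [i [[c ac] [gi cx]]] := gP x.
by exists i, c; rewrite gi.
Qed.

(** Countably many lifted charts cover, and each pulls back a countable basis of
    R^2n. *)
Lemma tangent_second_countable : @second_countable (tvec M).
Proof.
have [g [ga gcov]] := countable_atlas.
have /second_countableP[e [oe be]] := second_countable_row R (n + n).
pose b (ij : nat * nat) : set (tvec M) :=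
  if g ij.1 is Some c then [set p | chart_dom c (tbase p) /\ e ij.2 (tchart c p)]
  else set0.
exists (range b).
  by apply: card_le_trans (card_image_le _ _) _; exact: countableP.
split=> [_ [[i j] _ <-]|p A pA].
  rewrite /b/=; case E : (g i) => [c|]; last exact: open0.
  exact: tangent_subbase_open (ga _ _ E) (oe j).
have [i [c [gi cp]]] := gcov (tbase p).
have := lift_chart_inv_cvg cp.1 cp.2 pA.
move=> /be[j ej eA].
exists (b (i, j)).
  by split; [exists (i, j)|rewrite /b/= gi; split=> //; exact: cp.2].
rewrite /b/= gi => q [cq /eA[q' [cq' Aq']]].
by move=> /(lift_chart_inj cp.1 cq' cq) <-.
Qed.

(** Vectors over distinct points are separated in [M]; vectors over the same point
    lie in a common lifted chart. *)
Lemma tangent_hausdorff : hausdorff_space (tvec M).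
Proof.
have [hT _ _ _ _] := hM.
move=> p q pq.
have bpq : tbase p = tbase q.
  apply: hT => A B pA qB.
  have [r [Ar Br]] := pq _ _ (tbase_continuous pA) (tbase_continuous qB).
  by exists (tbase r).
have [c cp] := charts_ex hM (tbase p).
have cq : charts_at (tbase q) c by rewrite -bpq.
have hc := lift_chart_homeo cp.1.
apply: (lift_chart_inj cp.1 cp.2 cq.2).
apply: (@norm_hausdorff _ 'rV[R]_(n + n)) => A B pA qB.
have [r [Ar Br]] := pq _ _ (chart_continuous hc cp.2 pA) (chart_continuous hc cq.2 qB).
by exists (tchart c r).
Qed.

Lemma tangent_manifold : is_manifold TM.
Proof.
split.
- exact: tangent_hausdorff.
- exact: tangent_second_countable.
- move=> p; have [c cp] := charts_ex hM (tbase p).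
  by exists (lift_chart c); split; [exists c; [exact: cp.1|]|exact: cp.2].
- by move=> _ [c ac <-]; exact: lift_chart_homeo.
move=> _ _ [c ac <-] [d ad <-].
have hc := lift_chart_homeo ac.
rewrite smooth_onP; last first.
  apply: coord_dom_open => //; first exact: chart_open (lift_chart_homeo ad).
  by move=> p; exact: cvg_id.
move=> _ [p [cp dp] <-].
apply: smooth_at_near (smooth_at_lift_transition ac ad cp dp).
have nd := chart_dom_near (lift_chart_homeo ad) dp.
apply: filterS (chart_image_nbhs hc cp nd) => _ [q [cq dq] <-].
by rewrite (coord_repE hc)//= -tchart_transition.
Qed.

End TangentManifold.

(** * Borel maps on the sample space *)

Section Borel.
Variable R : realType.
Local Notation Omega := (Omega R).

Lemma borel_measurableP (T : topologicalType) (f : Omega -> T) :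
  borel_measurable f <-> forall U, open U -> measurable (f @^-1` U).
Proof.
split=> [bf U oU|H B]; first by apply: bf; exact: sub_sigma_algebra.
apply: (@smallest_sub _ _ _ [set B | measurable (f @^-1` B)]) => //=.
split=> [|A mA|F mF] /=.
- by rewrite preimage_set0; exact: measurable0.
- by rewrite setTD preimage_setC; exact: measurableC.
- by rewrite preimage_bigcup; exact: bigcupT_measurable.
Qed.

Lemma borel_closed (T : topologicalType) (f : Omega -> T) (C : set T) :
  borel_measurable f -> closed C -> measurable (f @^-1` C).
Proof.
move=> /borel_measurableP bf cC; rewrite -[C]setCK preimage_setC.
by apply: measurableC; exact: (bf (~` C) (closed_openC cC)).
Qed.

Lemma borel_comp (T S : topologicalType) (g : T -> S) (f : Omega -> T) :
  continuous g -> borel_measurable f -> borel_measurable (g \o f).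
Proof.
move=> cg /borel_measurableP bf; apply/borel_measurableP => U oU.
by rewrite comp_preimage; apply: bf; apply: open_comp => // x _; exact: cg.
Qed.

Lemma borel_cst (T : topologicalType) (x : T) :
  borel_measurable (fun _ : Omega => x).
Proof.
apply/borel_measurableP => U oU.
have [xU|xU] := pselect (U x).
  rewrite (_ : _ @^-1` _ = setT); first exact: measurableT.
  by apply/seteqP; split.
rewrite (_ : _ @^-1` _ = set0); first exact: measurable0.
by apply/seteqP; split.
Qed.

Lemma borel_pre (T : topologicalType) (f : Omega -> T) (Phi : Omega -> Omega) :
  borel_measurable f -> measurable_fun setT Phi -> borel_measurable (f \o Phi).
Proof.
move=> /borel_measurableP bf mPhi; apply/borel_measurableP => U oU.
by rewrite comp_preimage -[X in measurable X]setTI; apply: mPhi => //; exact: bf.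
Qed.

(** An open set of the product is a countable union of rectangles of basic open
    sets. *)
Lemma borel_pair (T S : topologicalType) (f : Omega -> T) (g : Omega -> S) :
  @second_countable T -> @second_countable S ->
  borel_measurable f -> borel_measurable g ->
  borel_measurable (fun w => (f w, g w)).
Proof.
move=> /second_countableP[e [oe be]] /second_countableP[e' [oe' be']].
move=> /borel_measurableP bf /borel_measurableP bg.
apply/borel_measurableP => U oU.
pose D := [set ij : nat * nat | e ij.1 `*` e' ij.2 `<=` U].
rewrite (_ : _ @^-1` _ = \bigcup_ij
    ([set _ | D ij] `&` (f @^-1` (e ij.1) `&` g @^-1` (e' ij.2)))).
  apply: countable_bigcupT_measurable => [|[i j]]; first exact: countableP.
  have [DU|DU] := pselect (D (i, j)).
    rewrite (_ : [set _ | _] = setT); last by apply/seteqP; split.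
    by rewrite setTI; apply: measurableI; [exact: bf|exact: bg].
  rewrite (_ : [set _ | _] = set0); last by apply/seteqP; split.
  by rewrite set0I; exact: measurable0.
apply/seteqP; split=> w /=.
  move=> Uw; have : nbhs (f w, g w) U by exact: open_nbhs_nbhs.
  move=> [[A B]/= [/be[i ei eA] /be'[j ej eB]] ABU].
  exists (i, j) => //=; split => // -[x y] /= [/eA Ax /eB By].
  by apply: ABU.
by move=> [[i j] /= _ [DU [fe ge]]]; apply: DU.
Qed.

Definition regular (T : topologicalType) := forall (x : T) (U : set T),
  nbhs x U -> exists2 V : set T, nbhs x V & closed V /\ V `<=` U.

(** Every basic open set which fits inside a closed subset of [U] selects one such
    closed set; regularity says that they exhaust [U]. *)
Lemma regular_cover (T : topologicalType) (U : set T) :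
  @second_countable T -> regular T -> open U ->
  exists C : nat -> set T, [/\ forall r, closed (C r), forall r, C r `<=` U &
    forall x, U x -> exists r, nbhs x (C r)].
Proof.
move=> /second_countableP[e [oe be]] rT oU.
have /choice[C CP] : forall r, exists C : set T, [/\ closed C, C `<=` U &
    (exists K, [/\ closed K, e r `<=` K & K `<=` U]) -> e r `<=` C].
  move=> r; have [[K [cK eK KU]]|nK] :=
      pselect (exists K, [/\ closed K, e r `<=` K & K `<=` U]).
    by exists K.
  by exists set0; split=> // ; exact: closed0.
exists C; split=> [r|r|x Ux]; [by have [] := CP r|by have [] := CP r|].
have [|V xV [cV VU]] := rT x U; first exact: open_nbhs_nbhs.
have [r er eV] := be _ _ xV.
exists r; have [_ _ H] := CP r.
apply: (@filterS _ _ _ (e r)); first by apply: H; exists V.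
by apply: open_nbhs_nbhs.
Qed.

Lemma regular_row n : regular 'rV[R]_n.
Proof.
move=> x U /nbhs_ballP[e /= e0 xU]; have e20 : 0 < e / 2 by rewrite divr_gt0.
exists (closed_ball x (e / 2)).
  by apply: filterS (nbhsx_ballx x _ e20) => y; exact: subset_closure.
split; first exact: closed_ball_closed.
apply: subset_trans xU; rewrite closed_ballE// => y; rewrite /closed_ball_/=.
rewrite -ball_normE/= => /le_lt_trans; apply.
by rewrite ltr_pdivrMr// ltr_pMr// ltr1n.
Qed.

(** With [C] as in [regular_cover], the limit lies in [U] if and only if the
    sequence is eventually in one of the closed sets [C r]. *)
Lemma borel_limit (T : topologicalType) (A : set Omega)
    (f : nat -> Omega -> T) (g : Omega -> T) (U : set T) :
  @second_countable T -> regular T -> measurable A ->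
  (forall k, borel_measurable (f k)) ->
  (forall w, A w -> f ^~ w @ \oo --> g w) ->
  open U -> measurable (A `&` g @^-1` U).
Proof.
move=> sT rT mA bf fg oU; have [C [cC CU Ccov]] := regular_cover sT rT oU.
rewrite (_ : _ `&` _ = A `&` \bigcup_r \bigcup_K
     \bigcap_(k in [set k | (K <= k)%N]) (f k @^-1` C r)).
  apply: measurableI => //; apply: bigcupT_measurable => r.
  apply: bigcupT_measurable => K; apply: bigcap_measurable => //.
    by exists K => /=.
  by move=> k _; exact: borel_closed.
apply/seteqP; split=> w [Aw].
  move=> /Ccov[r Cr]; have [K _ HK] := fg w Aw _ Cr.
  by split=> //; exists r => //; exists K => // k Kk; exact: HK.
move=> [r _ [K _ HK]]; split=> //; apply: (CU r).
apply: (closed_cvg _ (cC r) _ _ (fg w Aw)).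
by exists K => // k /HK.
Qed.

(** With [C] as in [regular_cover], [p (g w, Phi w)] lies in [U] if and only if for
    some [r] there are, at every scale, rational vectors [q] close to [g w] with
    [p (q, Phi w)] in [C r]: for one implication [p] maps a neighborhood of [g w]
    into [C r], for the other one passes to the limit. *)
Lemma borel_caratheodory (T : topologicalType) n (p : 'rV[R]_n * Omega -> T)
    (g : Omega -> 'rV[R]_n) (Phi : Omega -> Omega) :
  @second_countable T -> regular T ->
  (forall w, continuous (fun t => p (t, w))) ->
  (forall t, borel_measurable (fun w => p (t, w))) ->
  borel_measurable g -> measurable_fun setT Phi ->
  borel_measurable (fun w => p (g w, Phi w)).
Proof.
move=> sT rT cp bp bg mPhi; apply/borel_measurableP => U oU.
have [C [cC CU Ccov]] := regular_cover sT rT oU.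
pose d (q : 'rV[rat]_n) : 'rV[R]_n := map_mx ratr q.
pose B (k : nat) (q : 'rV[rat]_n) := g @^-1` (ball (d q) k.+1%:R^-1).
rewrite (_ : _ @^-1` _ = \bigcup_r \bigcap_k \bigcup_q
    (B k q `&` ((fun w => p (d q, w)) \o Phi) @^-1` C r)).
  apply: bigcupT_measurable => r; apply: bigcapT_measurable => k.
  apply: countable_bigcupT_measurable => [|q]; first exact: countableP.
  apply: measurableI.
    move/borel_measurableP: bg; apply; apply: ball_open; rewrite ?invr_gt0//.
  by apply: borel_closed => //; exact: borel_pre.
apply/seteqP; split=> w.
  move=> /Ccov[r]/(cp (Phi w) (g w))/nbhs_ballP[e /= e0 He]; exists r => // k _.
  pose e' := Num.min e k.+1%:R^-1.
  have e'0 : 0 < e' by rewrite lt_min e0 invr_gt0/=.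
  have [q gq] := ratr_dense_row (g w) e'0.
  move: gq; rewrite lt_min => /andP[q1 q2].
  exists q => //; split; first by rewrite /B/= -ball_normE/= distrC.
  by apply: He; rewrite -ball_normE.
move=> [r _ H]; apply: (CU r).
have /choice[q Hq] : forall k, exists q, B k q w /\ C r (p (d q, Phi w)).
  by move=> k; have [q _ [Bq Cq]] := H k I; exists q.
have dq : d (q k) @[k --> \oo] --> g w.
  apply/cvgrPdistC_lt => e e0.
  have := near_infty_natSinv_lt (PosNum e0); apply: filterS => k /= ke.
  have [] := Hq k; rewrite /B/= -ball_normE/= => /lt_trans + _; exact.
have := cvg_comp _ _ dq (cp (Phi w) (g w)).
move=> H1; apply: (closed_cvg _ (cC r) _ _ H1).
by apply: nearW => k; have [] := Hq k.
Qed.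

End Borel.

(** * Plots and sample-smooth maps *)

Section SSS.
Variable R : realType.

Lemma mixed_smoothP m n (g : Omega_ R m -> 'rV[R]_n) :
  mixed_smooth g <-> (forall w t, smooth_at (fun t => g (t, w)) t) /\
                     (forall t, borel_measurable (fun w => g (t, w))).
Proof.
split=> -[sg bg]; split=> // w.
  by move=> t; apply: (smooth_onP _ (@openT _)).1 => //.
by apply/(smooth_onP _ (@openT _)) => t _; exact: sg.
Qed.

Lemma smooth_at_continuous m (W : normedModType R) (f : 'rV[R]_m -> W) t :
  smooth_at f t -> {for t, continuous f}.
Proof. by move=> sf; exact: ck_continuous (sf 0%N). Qed.

(** The measurability clause is [borel_caratheodory]. *)
Lemma mixed_smooth_comp m n k (g : Omega_ R n -> 'rV[R]_k)
    (g' : Omega_ R m -> 'rV[R]_n) (Phi : Omega R -> Omega R) :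
  mixed_smooth g -> mixed_smooth g' -> measurable_fun setT Phi ->
  mixed_smooth (fun u => g (g' u, Phi u.2)).
Proof.
move=> /mixed_smoothP[sg bg] /mixed_smoothP[sg' bg'] mPhi.
apply/mixed_smoothP; split=> [w t|t] /=.
  have := smooth_at_comp (sg' w t) (sg (Phi w) (g' (t, w))); exact.
apply: (@borel_caratheodory R _ n g (fun w => g' (t, w)) Phi) => //.
- exact: second_countable_row.
- exact: regular_row.
- by move=> w s; exact: (smooth_at_continuous (sg w s)).
Qed.

Lemma site_map_comp m n k (h : Omega_ R n -> Omega_ R k)
    (h' : Omega_ R m -> Omega_ R n) :
  site_map h -> site_map h' -> site_map (h \o h').
Proof.
move=> [g [Phi [sg mPhi ->]]] [g' [Phi' [sg' mPhi' ->]]].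
exists (fun u => g (g' u, Phi' u.2)), (Phi \o Phi'); split => //.
  exact: (mixed_smooth_comp sg sg' mPhi').
move=> _ Y mY; rewrite comp_preimage.
have H := mPhi measurableT Y mY; rewrite setTI in H.
exact: (mPhi' measurableT _ H).
Qed.

Lemma const_mx_differentiable (s : R) :
  differentiable (fun x : R => const_mx x : 'rV[R]_1) s.
Proof.
rewrite (_ : (fun x : R => _) = (fun x => x *: (const_mx 1 : 'rV[R]_1))).
  exact: differentiableZl.
by apply/funext => x; apply/rowP => j; rewrite !mxE mulr1.
Qed.

Lemma real_plotP n (p : Omega_ R n -> R) :
  @plot R (real_sss R) n p <->
  (forall w t, smooth_at (fun t => p (t, w)) t) /\
  (forall t, borel_measurable (fun w => p (t, w))).
Proof.
split=> [/mixed_smoothP[sp bp]|[sp bp]].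
  split=> [w t k|t].
    have := (ck_row _ _ _).1 (sp w t k) 0.
    by under eq_fun do rewrite mxE.
  have := @borel_comp R _ _ (fun v : 'rV[R]_1 => v 0 0 : R) _ (@coord_continuous _ _ _ 0 0) (bp t).
  by rewrite /comp; under eq_fun do rewrite mxE.
apply/mixed_smoothP; split=> [w t k|t].
  by apply/ck_row => j; under eq_fun do rewrite mxE; exact: sp.
have c : continuous (fun x : R => const_mx x : 'rV[R]_1).
  by move=> x; exact: (differentiable_continuous (const_mx_differentiable x)).
exact: (borel_comp c (bp t)).
Qed.

Section Manifold.
Variable M : mfd R.
Hypothesis hM : is_manifold M.

Lemma mfd_plotP n (p : Omega_ R n -> M) :
  @plot R (mfd_sss M) n p <->
  (forall w t, smooth_into (fun t => p (t, w)) t) /\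
  (forall t, borel_measurable (fun w => p (t, w))).
Proof.
split=> -[sp bp]; split=> // w; first exact/(smooth_map_euclidean hM).
exact/(smooth_map_euclidean hM).
Qed.

Lemma manifold_second_countable : @second_countable M.
Proof. by have [] := hM. Qed.

(** As for [mixed_smooth_comp], with values in [M], which is regular. *)
Lemma is_sss_mfd : is_sss (mfd_sss M).
Proof.
split=> [n x|m n p h].
  apply/mfd_plotP; split=> [w t|t]; last exact: borel_cst.
  have [c cx] := charts_ex hM x.
  apply: (@smooth_into_intro R M hM _ _ _ c) => //.
    by apply: near_all => _; exact: cx.2.
  by move=> k; exact: ck_cst.
move=> /mfd_plotP[sp bp] [g [Phi [/mixed_smoothP[sg bg] mPhi ->]]].
apply/mfd_plotP; split=> [w t|t] /=.
  have := smooth_into_pre (sg w t) (sp (Phi w) (g (t, w))); exact.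
apply: (@borel_caratheodory R M n p (fun w => g (t, w)) Phi) => //.
- exact: manifold_second_countable.
- exact: manifold_regular.
- by move=> w s; exact: (smooth_into_continuous (sp w s)).
Qed.

Lemma sample_smooth_real (f : M -> R) : continuous f ->
  (forall m (p : 'rV[R]_m -> M) t, smooth_into p t -> smooth_at (f \o p) t) ->
  @sample_smooth R (mfd_sss M) (real_sss R) f.
Proof.
move=> cf sf n p /mfd_plotP[sp bp]; apply/real_plotP; split=> [w t|t].
  by have := sf _ _ _ (sp w t).
exact: (borel_comp cf (bp t)).
Qed.

Lemma sample_smooth_curve (g : R -> M) : continuous g ->
  (forall m (s : 'rV[R]_m -> R) t, smooth_at s t -> smooth_into (g \o s) t) ->
  @sample_smooth R (real_sss R) (mfd_sss M) g.
Proof.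
move=> cg sg n s /real_plotP[ss bs]; apply/mfd_plotP; split=> [w t|t].
  by have := sg _ _ _ (ss w t).
exact: (borel_comp cg (bs t)).
Qed.

Section Germ.
Variable g : R -> M.
Hypothesis sg : smooth_into (fun u : 'rV[R]_1 => g (u 0 0)) 0.

Lemma germ_continuous : {for 0, continuous g}.
Proof.
have E : g = (fun u : 'rV[R]_1 => g (u 0 0)) \o (fun x : R => const_mx x).
  by apply/funext => x /=; rewrite mxE.
rewrite E; apply: continuous_comp.
  exact/differentiable_continuous/const_mx_differentiable.
have -> : const_mx 0 = 0 :> 'rV[R]_1 by apply/rowP => j; rewrite !mxE.
exact: smooth_into_continuous.
Qed.

Lemma germ_derivable c : charts_at (g 0) c -> derivable (c \o g) 0 1.
Proof.
move=> cx.
have E : c \o g = (c \o (fun u : 'rV[R]_1 => g (u 0 0))) \o (fun x : R => const_mx x).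
  by apply/funext => x /=; rewrite mxE.
apply: (derivable1_diffP _ _).2; rewrite E.
apply: differentiable_comp; first exact: const_mx_differentiable.
have -> : const_mx 0 = 0 :> 'rV[R]_1 by apply/rowP => j; rewrite !mxE.
apply: smooth_at_differentiable; apply: (smooth_into_chart hM sg).
by rewrite mxE.
Qed.

End Germ.

(** Apply [g] to the plot of the real line which is constant in the sample. *)
Lemma curve_germ (g : curve (mfd_sss M)) t :
  smooth_into (fun u : 'rV[R]_1 => g (u 0 0)) t.
Proof.
have p : @plot R (real_sss R) 1 (fun u => u.1 0 0).
  apply/real_plotP; split=> [w s k|s] /=; first exact: ck_coord.
  exact: borel_cst.
have := sss_homP g p => /mfd_plotP[H _].
exact: (H point t).
Qed.

End Manifold.

Lemma sample_smooth_smooth_map (M N : mfd R) (f : M -> N) :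
  is_manifold M -> is_manifold N -> smooth_map f ->
  @sample_smooth R (mfd_sss M) (mfd_sss N) f.
Proof.
move=> hM hN sf n p /(mfd_plotP hM)[sp bp]; apply/(mfd_plotP hN); split=> [w t|t].
  by have := smooth_into_comp hM hN sf (sp w t).
exact: (borel_comp sf.1 (bp t)).
Qed.

Lemma is_sss_tangent (X : sss R) : is_sss (tangent X).
Proof.
split=> [n x|m n p h]; first by left; exists x.
move=> [[y ->] _|[p0 pp0 ->] sh]; first by left; exists y.
right; exists (p0 \o h) => // k h' q sh' pq.
by have := pp0 k (h \o h') q (site_map_comp sh sh') pq.
Qed.

End SSS.

(** * Velocities of curves and tangent classes *)

Lemma smooth_at_differentiableR (R : realType) m (f : 'rV[R]_m -> R) x :
  smooth_at f x -> differentiable f x.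
Proof.
move=> sf; pose F y : 'rV[R]_1 := const_mx (f y).
have sF : smooth_at F x.
  by move=> k; apply/ck_row => j; under eq_fun do rewrite mxE; exact: sf.
have -> : f = (fun v : 'rV[R]_1 => v 0 0) \o F by apply/funext => y; rewrite /F/= mxE.
apply: differentiable_comp; first exact: smooth_at_differentiable.
exact: differentiable_coord.
Qed.

(** Smooth functions on a manifold, tested along the smooth maps from R^m; this
    avoids differentiating coordinate representations. *)
Definition plotwise_smooth (R : realType) (M : mfd R) (W : normedModType R)
    (f : M -> W) : Prop :=
  continuous f /\
  forall m (p : 'rV[R]_m -> M) t, smooth_into p t -> smooth_at (f \o p) t.

(** The complement of [K] is open, and the function vanishes on it. *)
Lemma plotwise_smooth_glue (R : realType) (N : mfd R) (W : normedModType R)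
    (f : N -> W) (K : set N) :
  closed K -> (forall y, ~ K y -> f y = 0) ->
  (forall y, K y -> {for y, continuous f}) ->
  (forall m (p : 'rV[R]_m -> N) t, smooth_into p t -> K (p t) -> smooth_at (f \o p) t) ->
  plotwise_smooth f.
Proof.
move=> cK f0 cf sf.
have nK y : ~ K y -> \forall z \near y, f z = 0.
  move=> Ky; have : nbhs y (~` K).
    by apply: open_nbhs_nbhs; split=> //; exact: closed_openC.
  by apply: filterS.
split=> [y|m p t mp].
  have [/cf//|Ky] := pselect (K y).
  apply: (@near_eq_continuous _ _ (fun=> 0)); last exact: cst_continuous.
  by apply: filterS (nK y Ky).
have [Ky|Ky] := pselect (K (p t)); first exact: sf.
apply: (@smooth_at_near _ _ _ (fun=> 0)); last by move=> k; exact: ck_cst.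
by apply: filterS (continuous_near (smooth_into_continuous mp) (nK _ Ky)) => s /= ->.
Qed.

Section PSmooth.
Variables (R : realType) (M : mfd R).
Hypothesis hM : is_manifold M.

(** Room for a bump function of radius [e] around [x]: closedness allows extension
    by zero, and the factor 2 lets the points of the ball be moved by less than [e]
    inside the chart. *)
Definition safe_radius (c : chart R M (mfd_dim M)) (x : M) (e : R) :=
  [/\ 0 < e, closed (chart_dom c `&` [set y | `|c y - c x| <= e]) &
      forall u, `|u - c x| < 2 * e -> (c @` chart_dom c) u].

Lemma safe_radius_ex (x : M) c : charts_at x c -> exists e, safe_radius c x e.
Proof.
move=> cx; have [e e0 He] := chart_ball hM cx (filterT : nbhs x setT).
have e20 : 0 < e / 2 by rewrite divr_gt0.
have e2e : e / 2 <= e by rewrite ler_pdivrMr// ler_peMr ?ler1n// ltW.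
exists (e / 2); split=> //; first exact: (He _ e20 e2e).2.
move=> u ue; have [|y [cy _] yu] := (He e e0 (lexx e)).1 u.
  by rewrite ltW// (lt_le_trans ue)// mulrC divfK.
by exists y.
Qed.

Definition chart_bump (c : chart R M (mfd_dim M)) (x : M) (e : R) (y : M) : R :=
  if `[< chart_dom c y >] then cube_bump (e^-1 *: (c y - c x)) else 0.

Lemma chart_bump_ge0 c x e y : 0 <= chart_bump c x e y.
Proof. by rewrite /chart_bump; case: ifP => // _; exact: cube_bump_ge0. Qed.

Lemma chart_bump_gt0 c x e : chart_dom c x -> 0 < chart_bump c x e x.
Proof.
by move=> cx; rewrite /chart_bump ifT ?subrr ?scaler0 ?cube_bump0_gt0//; exact/asboolP.
Qed.

Lemma chart_bump_supp c x e y : 0 < e -> chart_bump c x e y != 0 ->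
  chart_dom c y /\ `|c y - c x| < e.
Proof.
move=> e0; rewrite /chart_bump; case: ifPn => [/asboolP cy|]; last by rewrite eqxx.
move=> /cube_bump_supp; rewrite normrZ normfV (gtr0_norm e0) => H; split=> //.
by rewrite ltr_pdivrMl ?mulr1 in H.
Qed.

Lemma smooth_at_affine m k (a : R) (v : 'rV[R]_k) (q : 'rV[R]_m -> 'rV[R]_k) t :
  smooth_at q t -> smooth_at (fun s => a *: (q s - v)) t.
Proof.
move=> sq d; apply/ck_row => j.
have := ckM (ck_cst d a t) (ckD ((ck_row _ _ _).1 (sq d) j) (ck_cst d (- v 0 j : R) t)).
by apply: ck_near; apply: near_all => s; rewrite !mxE.
Qed.

Lemma smooth_at_id m (t : 'rV[R]_m) : smooth_at (id : 'rV[R]_m -> 'rV[R]_m) t.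
Proof. by move=> d; apply/ck_row => j; exact: ck_coord. Qed.

Lemma plotwise_smooth_cutoff (F : 'rV[R]_(mfd_dim M) -> R) c x e :
  charts_at x c -> safe_radius c x e ->
  (forall m (q : 'rV[R]_m -> 'rV[R]_(mfd_dim M)) t,
     smooth_at q t -> smooth_at (F \o q) t) ->
  plotwise_smooth (fun y => chart_bump c x e y * F (c y)).
Proof.
move=> cx [e0 cK _] sF.
pose G u := cube_bump (e^-1 *: (u - c x)) * F u.
have sG m (q : 'rV[R]_m -> 'rV[R]_(mfd_dim M)) t :
    smooth_at q t -> smooth_at (G \o q) t.
  move=> sq k; apply: ckM; last exact: sF.
  by apply: ck_cube_bump; exact: smooth_at_affine.
have hc := charts_homeo hM cx.
have fG y : chart_dom c y ->
    \forall z \near y, G (c z) = chart_bump c x e z * F (c z).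
  move=> /(chart_dom_near hc); apply: filterS => z cz.
  by rewrite /G /chart_bump ifT//; exact/asboolP.
apply: (plotwise_smooth_glue cK) => [y nK|y [cy _]|m p t mp [cy _]].
- suff -> : chart_bump c x e y = 0 by rewrite mul0r.
  apply/eqP/negP => /negP/(chart_bump_supp e0)[cy ye]; apply: nK.
  by split=> //; exact: ltW.
- apply: (@near_eq_continuous _ _ (G \o c)); first exact: fG.
  apply: continuous_comp; first exact: chart_continuous.
  exact: (smooth_at_continuous (sG _ _ _ (@smooth_at_id _ _))).
- apply: smooth_at_near (sG _ _ _ (smooth_into_chart hM mp (conj cx.1 cy))).
  exact: (continuous_near (smooth_into_continuous mp) (fG _ cy)).
Qed.

Lemma plotwise_smooth_bump c x e : charts_at x c -> safe_radius c x e ->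
  plotwise_smooth (chart_bump c x e).
Proof.
move=> cx re; rewrite (_ : chart_bump c x e = fun y => chart_bump c x e y * cst 1 (c y)).
  by apply: (@plotwise_smooth_cutoff (cst 1)) => // m q t _ k; exact: ck_cst.
by apply/funext => y; rewrite mulr1.
Qed.

Lemma plotwise_smooth_sample (f : M -> R) : plotwise_smooth f ->
  @sample_smooth R (mfd_sss M) (real_sss R) f.
Proof. by move=> [cf sf]; exact: sample_smooth_real. Qed.

(** Test the equivalence on a bump function times [F], the [j]-th coordinate
    centered at the base point: since [F] vanishes there, the derivative along a
    curve is the [j]-th coordinate of the velocity times the value of the bump. *)
Lemma tangent_rel_velocity (g h : curve (mfd_sss M)) c :
  tangent_rel g h -> charts_at (g 0 : M) c ->
  'D_1 (c \o (g : R -> M)) 0 = 'D_1 (c \o (h : R -> M)) 0.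
Proof.
move=> /asboolP[gh0 H] cx; have [e re] := safe_radius_ex cx.
have [e0 _ _] := re.
have hc := charts_homeo hM cx.
apply/rowP => j.
pose F (u : 'rV[R]_(mfd_dim M)) : R := (u - c (g 0)) 0 j.
have sF m (q : 'rV[R]_m -> 'rV[R]_(mfd_dim M)) t :
    smooth_at q t -> smooth_at (F \o q) t.
  move=> sq k; have := (ck_row _ _ _).1 (smooth_at_affine 1 (c (g 0)) sq k) j.
  by apply: ck_near; apply: near_all => s; rewrite scale1r.
have pf := plotwise_smooth_cutoff cx re sF.
have := H (SssHom (plotwise_smooth_sample pf)).
rewrite !derive1E.
pose A u := cube_bump (e^-1 *: (u - c (g 0))).
have E (k : curve (mfd_sss M)) : k 0 = g 0 ->
    'D_1 ((fun y : M => chart_bump c (g 0) e y * F (c y)) \o (k : R -> M)) 0 =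
    cube_bump (0 : 'rV[R]_(mfd_dim M)) * ('D_1 (c \o (k : R -> M)) 0) 0 j.
  move=> k0; have gk := curve_germ hM k 0.
  have ck0 := germ_continuous gk.
  have cxk : charts_at (k 0 : M) c by rewrite k0.
  have dk := germ_derivable hM gk cxk.
  have diffk : differentiable (c \o (k : R -> M)) 0 := (derivable1_diffP _ _).1 dk.
  pose B t : R := F (c (k t)).
  have nE : \forall t \near (0 : R), ((A \o (c \o (k : R -> M))) * B) t =
      ((fun y : M => chart_bump c (g 0) e y * F (c y)) \o (k : R -> M)) t.
    apply: filterS (continuous_near ck0 (chart_dom_near hc cxk.2)) => t ct.
    by rewrite /= /chart_bump ifT//; exact/asboolP.
  rewrite -(near_eq_derive _ nE).
  have dA : derivable (A \o (c \o (k : R -> M))) 0 1.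
    apply: (derivable1_diffP _ _).2; apply: differentiable_comp => //.
    apply: smooth_at_differentiableR => d; apply: ck_cube_bump.
    exact: (smooth_at_affine _ _ (@smooth_at_id _ _)).
  have dB0 : derivable (fun t => (c (k t)) 0 j) 0 1.
    by have /derivable_mxP/(_ 0 j) := dk.
  have BE : B = (fun t => (c (k t)) 0 j) - cst (c (g 0) 0 j).
    by apply/funext => t; rewrite /B /F !mxE.
  have dC : derivable (cst (c (g 0) 0 j) : R -> R) 0 1 by exact: derivable_cst.
  have dB : derivable B 0 1 by rewrite BE; exact: (derivableB dB0 dC).
  rewrite (deriveM dA dB).
  have -> : B 0 = 0 by rewrite /B /F k0 subrr mxE.
  rewrite scale0r addr0 BE (deriveB dB0 dC).
  rewrite derive_cst subr0 /= /A k0 subrr scaler0.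
  by congr (_ * _); rewrite (derive_mx dk) mxE.
rewrite (E g erefl) (E h (esym gh0)) => EE; apply: (mulfI _ EE).
by rewrite gt_eqF// cube_bump0_gt0.
Qed.

(** The map [phi] parametrizes part of the chart by all of R^n, hence is a plot, so
    that [f \o phi] is smooth.  It inverts [c - c x] near [x], whence
    [f \o g = (f \o phi) \o (c \o g - c x)] near 0 and similarly for [h]. *)
Lemma velocity_tangent_rel (g h : curve (mfd_sss M)) c :
  charts_at (g 0 : M) c -> g 0 = h 0 ->
  'D_1 (c \o (g : R -> M)) 0 = 'D_1 (c \o (h : R -> M)) 0 ->
  tangent_rel g h.
Proof.
move=> cx gh0 ghD; apply/asboolP; split=> // f.
have hc := charts_homeo hM cx.
have [e e0 /(_ e e0 (lexx e))[He _]] := chart_ball hM cx (filterT : nbhs (g 0 : M) setT).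
pose x : M := g 0.
pose phi (u : 'rV[R]_(mfd_dim M)) : M := chart_inv c x (squash e u + c x).
have phiP u : chart_dom c (phi u) /\ c (phi u) = squash e u + c x.
  apply: (chart_invP x); have [|y [cy _] yu] := He (squash e u + c x).
    by rewrite addrK ltW// squash_lt.
  by exists y.
have sphi u : smooth_into phi u.
  apply: (@smooth_into_intro R M hM _ phi u c).
  - by split; [exact: cx.1|exact: (phiP u).1].
  - by apply: near_all => v; exact: (phiP v).1.
  move=> k; apply: ck_near (ckD (ck_squash e (@smooth_at_id _ u k)) (ck_cst k (c x) u)).
  by apply: near_all => v; rewrite /= (phiP v).2.
have pphi : @plot R (mfd_sss M) _ (fun u => phi u.1).
  by apply/(mfd_plotP hM); split=> [w t|t]; [exact: sphi|exact: (borel_cst (phi t))].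
have sfphi u : smooth_at (fun v => f (phi v)) u.
  by have /real_plotP[/(_ point u)] := sss_homP f pphi.
rewrite !derive1E.
have E (k : curve (mfd_sss M)) : k 0 = x ->
    'D_1 ((f : M -> R) \o (k : R -> M)) 0 =
    'd (fun v => f (phi v)) 0 ('D_1 (c \o (k : R -> M)) 0).
  move=> k0; have gk := curve_germ hM k 0.
  have ck0 := germ_continuous gk.
  have cxk : charts_at (k 0 : M) c by rewrite k0.
  have dk := germ_derivable hM gk cxk.
  pose q t := c (k t) - c x.
  have qE : q = (c \o (k : R -> M)) - cst (c x) by [].
  have dC : derivable (cst (c x) : R -> 'rV[R]_(mfd_dim M)) 0 1.
    exact: derivable_cst.
  have dq : derivable q 0 1 by rewrite qE; exact: (derivableB dk dC).
  have Dq : 'D_1 q 0 = 'D_1 (c \o (k : R -> M)) 0.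
    by rewrite qE (deriveB dk dC) derive_cst subr0.
  have diffq : differentiable q 0 := (derivable1_diffP _ _).1 dq.
  have q0 : q 0 = 0 by rewrite /q k0 subrr.
  have nq : \forall t \near (0 : R), `|q t| <= e / 2.
    have e20 : 0 < e / 2 by rewrite divr_gt0.
    have cq : {for 0, continuous q} := differentiable_continuous diffq.
    have /cvgrPdistC_le/(_ _ e20) := cq.
    by apply: filterS => t; rewrite q0 subr0.
  have nE : \forall t \near (0 : R), ((fun v => f (phi v)) \o q) t = f (k t).
    apply: filterS2 nq (continuous_near ck0 (chart_dom_near hc cxk.2)) => t qt ct.
    by rewrite /= /phi squash_id// /q subrK chart_invK.
  rewrite -(near_eq_derive _ nE).
  have dfphi : differentiable (fun v => f (phi v)) (q 0).
    exact: smooth_at_differentiableR.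
  rewrite deriveE; last exact: differentiable_comp.
  by rewrite (diff_comp diffq dfphi) -Dq (deriveE (1 : R) diffq) /= q0.
by rewrite (E g erefl) (E h (esym gh0)) ghD.
Qed.

Lemma velocity_ex (g : curve (mfd_sss M)) : exists p, is_velocity g p.
Proof.
have [c cx] := charts_ex hM (g 0 : M).
have gk := curve_germ hM g 0.
have [p [px pc]] := tvec_ex hM ('D_1 (c \o (g : R -> M)) 0) cx.
exists p; split=> // d dx; rewrite derive1E.
have cp : charts_at (tbase p) c by rewrite px.
have dp : charts_at (tbase p) d by rewrite px.
rewrite (tcomp_change cp dp) pc px.
have := derive_curve hM hM (smooth_map_id hM) (germ_continuous gk) cx dx
  (germ_derivable hM gk cx).
by move=> [_ <-].
Qed.

Lemma velocity_uniq (g : curve (mfd_sss M)) p q :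
  is_velocity g p -> is_velocity g q -> p = q.
Proof.
move=> [px pc] [qx qc]; have [c cx] := charts_ex hM (g 0 : M).
by apply: (@tvec_eq R M p q c); rewrite ?px ?qx ?pc ?qc.
Qed.

Lemma velocity_rel (g h : curve (mfd_sss M)) p :
  tangent_rel g h -> is_velocity g p -> is_velocity h p.
Proof.
move=> gh [px pc]; have /asboolP[gh0 _] := gh.
split; first by rewrite px gh0.
move=> c; rewrite -gh0 => cx; rewrite pc// !derive1E.
exact: tangent_rel_velocity.
Qed.

Lemma velocity_inj (g h : curve (mfd_sss M)) p :
  is_velocity g p -> is_velocity h p -> tangent_rel g h.
Proof.
move=> [gx gc] [hx hc]; have [c cx] := charts_ex hM (g 0 : M).
apply: (velocity_tangent_rel cx); first by rewrite -gx -hx.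
by rewrite -!derive1E -gc// -hc// -hx gx.
Qed.

Lemma velocity_map_ex : exists E : tangent (mfd_sss M) -> mfd_sss (tangent_bundle M),
  is_velocity_map E.
Proof.
have /choice[E EP] : forall tau : tangent (mfd_sss M),
    exists p : tvec M, is_velocity (tangent_repr tau) p.
  by move=> tau; exact: velocity_ex.
exists E => g; apply: velocity_rel (EP _).
by apply/tangent_classP; rewrite tangent_reprK.
Qed.

End PSmooth.

(** * Moving points inside one chart *)

Section Stepper.
Variables (R : realType) (M : mfd R).
Hypothesis hM : is_manifold M.
Local Notation TM := (tangent_bundle M).
Local Notation n := (mfd_dim M).
Let hTM : is_manifold TM := tangent_manifold hM.

Lemma tchart_smooth m (V : 'rV[R]_m -> TM) t c : smooth_into V t ->
  charts_at (tbase (V t)) c -> smooth_at (fun s => tchart c (V s)) t.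
Proof.
move=> mV cV.
apply: (@smooth_into_chart R TM hTM m V t (lift_chart c) mV).
by split; [exists c; [exact: cV.1|]|exact: cV.2].
Qed.

Lemma tbase_smooth_into m (V : 'rV[R]_m -> TM) t : smooth_into V t ->
  smooth_into (fun s => tbase (V s)) t.
Proof.
move=> mV; have [c cx] := charts_ex hM (tbase (V t)).
have cV : {for t, continuous (fun s => tbase (V s))}.
  apply: (continuous_comp (smooth_into_continuous mV)); exact: tbase_continuous.
apply: (@smooth_into_intro R M hM _ _ _ c) => //.
  exact: (continuous_near cV (chart_dom_near (charts_homeo hM cx) cx.2)).
have H := smooth_at_comp (tchart_smooth mV cx) (@smooth_at_lsubmx R n n _).
by apply: smooth_at_near H; apply: near_all => s; rewrite /= row_mxKl.
Qed.

Lemma smooth_at_scale m k (a : 'rV[R]_m -> R) (f : 'rV[R]_m -> 'rV[R]_k) t :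
  smooth_at a t -> smooth_at f t -> smooth_at (fun s => a s *: f s) t.
Proof.
move=> sa sf d; apply/ck_row => j.
have := ckM (sa d) ((ck_row _ _ _).1 (sf d) j).
by apply: ck_near; apply: near_all => s; rewrite !mxE.
Qed.

Lemma rsubmx_continuous m k : continuous (rsubmx : 'rV[R]_(m + k) -> 'rV[R]_k).
Proof. by move=> w; exact: (smooth_at_continuous (@smooth_at_rsubmx R m k w)). Qed.

(** The curve [y] leaves the base point of [v] with velocity [k v]. *)
Definition moves (v : tvec M) (k : R) (y : R -> M) : Prop :=
  [/\ y 0 = tbase v, {for 0, continuous y} &
      forall c, charts_at (tbase v) c ->
        derivable (c \o y) 0 1 /\ 'D_1 (c \o y) 0 = k *: tcomp v c].

(** Velocities change by the differential of the change of charts, which is linear,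
    exactly as the components of [v] do. *)
Lemma moves_chart (v : tvec M) (k : R) (y : R -> M) c :
  y 0 = tbase v -> {for 0, continuous y} ->
  charts_at (tbase v) c -> derivable (c \o y) 0 1 ->
  'D_1 (c \o y) 0 = k *: tcomp v c -> moves v k y.
Proof.
move=> y0 cy cx dy Dy; split; [exact: y0|exact: cy|move=> d dx].
have cx0 : charts_at (y 0) c by rewrite y0.
have dx0 : charts_at (y 0) d by rewrite y0.
have [H1 H2] := derive_curve hM hM (smooth_map_id hM) cy cx0 dx0 dy.
split; first exact: H1.
have -> : 'D_1 (d \o y) 0 = 'D_('D_1 (c \o y) 0) (coord_rep c d id) (c (y 0)) by [].
have dif : differentiable (coord_rep c d (id : M -> M)) (c (y 0)).
  apply: smooth_at_differentiable.
  exact: (coord_rep_smooth hM hM (smooth_map_id hM) cx0 dx0).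
by rewrite Dy deriveE// linearZ/= -deriveE// y0 -(tcomp_change cx dx).
Qed.

(** A way of moving the points of [M] for some time, steered by a tangent vector;
    [b] is the rate at which it contributes to velocities.  Continuity is asked
    along arbitrary spaces and smoothness along R^m, in all variables at once, so
    that a step can be applied to the outcome of earlier ones. *)
Record stepper (b : M -> R) (st : tvec M -> R -> M -> M) : Prop := Stepper {
  stepper_id : forall v s y, b (tbase v) = 0 -> st v s y = y;
  stepper_cont : forall (Z : topologicalType) (V : Z -> tvec M) (s : Z -> R)
      (y : Z -> M) z,
    {for z, continuous V} -> {for z, continuous s} -> {for z, continuous y} ->
    {for z, continuous (fun z => st (V z) (s z) (y z))};
  stepper_smooth : forall m (V : 'rV[R]_m -> TM) (s : 'rV[R]_m -> R)
      (y : 'rV[R]_m -> M) t,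
    smooth_into V t -> smooth_at s t -> smooth_into y t ->
    smooth_into (fun t => st (V t) (s t) (y t)) t;
  stepper_moves : forall v sigma k y, moves v k y ->
    moves v (k + sigma * b (tbase v)) (fun s => st v (s * sigma) (y s)) }.

Lemma trivial_stepper : stepper (fun=> 0) (fun v s y => y).
Proof.
split=> // v sigma k y; by rewrite mulr0 addr0.
Qed.

Section ChartStepper.
Variables (c : chart R M n) (x : M) (e : R) (a : M -> R).
Hypotheses (cx : charts_at x c) (re : safe_radius c x e) (pa : plotwise_smooth a).
Hypothesis supp_a : forall y, a y != 0 -> chart_bump c x e y != 0.

Let hc : is_local_homeo c := charts_homeo hM cx.
Let e0 : 0 < e. Proof. by have [] := re. Qed.
Let K := chart_dom c `&` [set y | `|c y - c x| <= e].
Let cK : closed K. Proof. by have [] := re. Qed.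

Let a_out y : ~ K y -> a y = 0.
Proof.
move=> nK; apply/eqP/negP => /negP/supp_a/(chart_bump_supp e0)[cy ye]; apply: nK.
by split=> //; exact: ltW.
Qed.

Let field (v : tvec M) : 'rV[R]_n := a (tbase v) *: tcomp v c.

Let field_rsub v : field v = a (tbase v) *: rsubmx (tchart c v).
Proof. by rewrite row_mxKr. Qed.

(** The component of a vector in [c] is only meaningful over the chart, but [a]
    vanishes outside a closed part of it: extend by zero. *)
Let plotwise_smooth_field : plotwise_smooth (field : TM -> 'rV[R]_n).
Proof.
apply: (@plotwise_smooth_glue R TM _ _ (@tbase R M @^-1` K)).
- by apply: closed_comp => // v _; exact: tbase_continuous.
- by move=> v /a_out va; rewrite /field va scale0r.
- move=> v [cv _].
  have -> : field = (fun v => a (tbase v) *: rsubmx (tchart c v)).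
    by apply/funext => w; exact: field_rsub.
  apply: continuousZ.
    by apply: continuous_comp; [exact: tbase_continuous|exact: pa.1].
  apply: (@continuous_comp _ _ _ (tchart c) rsubmx); last exact: rsubmx_continuous.
  by apply: (chart_continuous (lift_chart_homeo hM cx.1)).
- move=> m V t mV [cv _].
  have H1 := pa.2 _ _ _ (tbase_smooth_into mV).
  have H2 := smooth_at_comp (tchart_smooth mV (conj cx.1 cv)) (@smooth_at_rsubmx R n n _).
  apply: smooth_at_near (smooth_at_scale H1 H2).
  by apply: near_all => s; rewrite /= field_rsub.
Qed.

(** The point [y] moves in the chart by [s a(y) a(pi v) v], squashed so as not to
    leave it.  The factor [a y] makes the motion die out before the edge of the
    chart, [a (pi v)] before [v] does. *)
Let step v s y : M :=
  if `[< chart_dom c y >] then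
    chart_inv c y (c y + squash e ((s * a y) *: field v))
  else y.

Let step_dom v s y : chart_dom c y -> chart_dom c (step v s y) /\
  c (step v s y) = c y + squash e ((s * a y) *: field v).
Proof.
move=> cy; rewrite /step ifT; last exact/asboolP.
apply: chart_invP.
have [->|ay0] := eqVneq (a y) 0.
  by rewrite mulr0 scale0r squash0// addr0; exists y.
have [_ ye] := chart_bump_supp e0 (supp_a ay0).
have [_ _] := re; apply.
rewrite addrAC mulr_natl mulr2n (le_lt_trans (ler_normD _ _))// ltrD// squash_lt//.
Qed.

Let step_id v s y : a y *: field v = 0 -> step v s y = y.
Proof.
move=> H; rewrite /step -scalerA H scaler0 squash0// addr0.
by case: asboolP => // cy; rewrite chart_invK.
Qed.

Let step_out v s y : ~ K y -> step v s y = y.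
Proof. by move=> /a_out ay; apply: step_id; rewrite ay scale0r. Qed.

Let nK y : ~ K y -> \forall z \near y, ~ K z.
Proof.
by move=> Ky; apply: open_nbhs_nbhs; split=> //; exact: closed_openC.
Qed.

(** Continuity and smoothness hold inside the chart by the formula, and outside the
    support of [a] because nothing moves.  The factor [a] occurs twice, at [y] and
    at the base point, hence the square. *)
Lemma chart_stepper : exists st, stepper (fun y => a y ^+ 2) st.
Proof.
exists step; split.
- move=> v s y /eqP; rewrite expf_eq0/= => /eqP av.
  by apply: step_id; rewrite /field av scale0r scaler0.
- move=> Z V s y z cV cs cy.
  have [cyz|cyz] := pselect (chart_dom c (y z)).
    apply: (continuous_of_chart hc); first exact: (step_dom _ _ cyz).1.
      apply: filterS (continuous_near cy (chart_dom_near hc cyz)) => w cw.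
      exact: (step_dom _ _ cw).1.
    apply: (@near_eq_continuous _ _
       (fun z => c (y z) + squash e ((s z * a (y z)) *: field (V z)))).
      apply: filterS (continuous_near cy (chart_dom_near hc cyz)) => w cw.
      by rewrite /= (step_dom _ _ cw).2.
    apply: continuousD.
      by apply: continuous_comp cy _; exact: chart_continuous.
    apply: (@continuous_comp _ _ _ (fun z => (s z * a (y z)) *: field (V z)) (squash e)).
      apply: continuousZ.
        apply: continuousM => //; apply: (continuous_comp cy); exact: pa.1.
      apply: (continuous_comp cV); exact: plotwise_smooth_field.1.
    by apply: smooth_at_continuous => k; apply: ck_squash; exact: smooth_at_id.
  have yK : ~ K (y z) by case.
  apply: (near_eq_continuous _ cy).
  by apply: filterS (continuous_near cy (nK yK)) => w /step_out ->.
- move=> m V s y t mV ss my; have cy := smooth_into_continuous my.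
  have [cyz|cyz] := pselect (chart_dom c (y t)).
    apply: (@smooth_into_intro R M hM _ _ _ c).
    - by split; [exact: cx.1|exact: (step_dom _ _ cyz).1].
    - apply: filterS (continuous_near cy (chart_dom_near hc cyz)) => w cw.
      exact: (step_dom _ _ cw).1.
    apply: (@smooth_at_near _ _ _
       (fun z => c (y z) + squash e ((s z * a (y z)) *: field (V z)))).
      apply: filterS (continuous_near cy (chart_dom_near hc cyz)) => w cw.
      by rewrite /= (step_dom _ _ cw).2.
    move=> k; apply: ckD.
      exact: (smooth_into_chart hM my (conj cx.1 cyz) k).
    apply: ck_squash; apply: smooth_at_scale; last exact: plotwise_smooth_field.2.
    by move=> d; apply: ckM; [exact: ss|exact: pa.2].
  have yK : ~ K (y t) by case.
  apply: (smooth_into_near _ my).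
  by apply: filterS (continuous_near cy (nK yK)) => w /step_out ->.
move=> v sigma k y mv; have [y0 cy dy] := mv.
have [a0|a0] := eqVneq (a (tbase v)) 0.
  rewrite a0 expr0n/= mulr0 addr0.
  have -> : (fun s => step v (s * sigma) (y s)) = y; last by [].
  by apply/funext => s; apply: step_id; rewrite /field a0 scale0r scaler0.
have [cv _] := chart_bump_supp e0 (supp_a a0).
have cvv : charts_at (tbase v) c by split=> //; exact: cx.1.
have ny : \forall s \near (0 : R), chart_dom c (y s).
  by apply: (continuous_near cy); rewrite y0; exact: chart_dom_near.
have [dcy Dcy] := dy c cvv.
pose w (s : R) := (s * sigma * a (y s)) *: field v.
have w0 : w 0 = 0 by rewrite /w !mul0r scale0r.
have cay : {for 0, continuous (fun s => a (y s))}.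
  by apply: (continuous_comp cy); exact: pa.1.
have Dw : is_derive (0 : R) (1 : R) w ((sigma * a (tbase v)) *: field v).
  (* [w s] is [s] times a continuous function, whose value at 0 is the derivative *)
  have H : (fun h : R => h^-1 *: (w (h *: 1 + 0) - w 0)) @ 0^' -->
           (sigma * a (tbase v)) *: field v.
    have C : {for 0, continuous (fun s => (sigma * a (y s)) *: field v)}.
      apply: continuousZ; last exact: cst_continuous.
      by apply: continuousM => //; exact: cst_continuous.
    have C' : (fun s => (sigma * a (y s)) *: field v) @ 0^' -->
              (sigma * a (tbase v)) *: field v.
      rewrite -y0; apply: cvg_trans C; apply: cvg_fmap2; exact: cvg_within.
    apply: cvg_trans C'; apply: near_eq_cvg; near=> h.
    have h0 : h != 0 by near: h; exact: nbhs_dnbhs_neq.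
    rewrite w0 subr0 addr0 [h *: 1]mulr1 /w [RHS]scalerA.
    congr (_ *: _). by rewrite -[h * sigma * _]mulrA mulKf.
  by apply: DeriveDef; [apply/cvg_ex; eexists; exact: H|exact: cvg_lim].
have cw : {for 0, continuous w}.
  by apply: derivable1_continuous; exact: (@ex_derive _ _ _ _ _ _ _ Dw).
have nw : \forall s \near (0 : R), `|w s| <= e / 2.
  have e20 : 0 < e / 2 by rewrite divr_gt0.
  have /cvgrPdistC_le/(_ _ e20) := cw.
  by apply: filterS => s; rewrite w0 subr0.
have nE : \forall s \near (0 : R), (c \o y + w) s =
    (c \o (fun s => step v (s * sigma) (y s))) s.
  apply: filterS2 ny nw => s cys ws.
  by rewrite /= (step_dom _ _ cys).2 squash_id.
have Dcy' : is_derive (0 : R) (1 : R) (c \o y) (k *: tcomp v c).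
  by apply: DeriveDef; [exact: dcy|exact: Dcy].
have DD := near_eq_is_derive nE (is_deriveD Dcy' Dw).
have st0 : step v (0 * sigma) (y 0) = y 0.
  rewrite /step mul0r mul0r scale0r squash0// addr0.
  by case: asboolP => // cy0; rewrite chart_invK.
pose z (s : R) := step v (s * sigma) (y s).
have z0 : z 0 = tbase v by rewrite /z st0.
have Dz := @ex_derive _ _ _ _ _ _ _ DD.
have cz : {for 0, continuous z}.
  apply: (continuous_of_chart hc).
  - by rewrite z0.
  - by apply: filterS ny => s cys; exact: (step_dom _ _ cys).1.
  - exact: derivable1_continuous Dz.
apply: (@moves_chart v _ z c z0 cz cvv); first exact: Dz.
rewrite [LHS](@derive_val _ _ _ _ _ _ _ DD) /field scalerA scalerDl.
by congr (_ + _ *: _); rewrite expr2 mulrA.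
Unshelve. all: by end_near. Qed.

End ChartStepper.
End Stepper.

(** * A local addition *)

Section LocallyFinite.
Variables (R : realType) (M : mfd R).
Hypothesis hM : is_manifold M.
Local Notation TM := (tangent_bundle M).
Local Notation n := (mfd_dim M).
Let hTM : is_manifold TM := tangent_manifold hM.

Lemma plotwise_smooth_cst (W : normedModType R) (w : W) : plotwise_smooth (fun _ : M => w).
Proof. by split=> [|m p t _ k]; [exact: cst_continuous|exact: ck_cst]. Qed.

Lemma plotwise_smoothM (f g : M -> R) :
  plotwise_smooth f -> plotwise_smooth g -> plotwise_smooth (fun y => f y * g y).
Proof.
move=> [cf sf] [cg sg]; split=> [y|m p t mp k].
  by apply: continuousM; [exact: cf|exact: cg].
by apply: ckM; [exact: sf|exact: sg].
Qed.

Lemma plotwise_smoothD (f g : M -> R) :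
  plotwise_smooth f -> plotwise_smooth g -> plotwise_smooth (fun y => f y + g y).
Proof.
move=> [cf sf] [cg sg]; split=> [y|m p t mp k].
  by apply: continuousD; [exact: cf|exact: cg].
by apply: ckD; [exact: sf|exact: sg].
Qed.

Lemma plotwise_smooth_flat k (f : M -> R) : plotwise_smooth f -> plotwise_smooth (fun y => flat k (f y)).
Proof.
move=> [cf sf]; split=> [y|m p t mp d].
  by apply: (continuous_comp (cf y)); exact: flat_continuous.
by apply: ck_flat; exact: sf.
Qed.

Lemma plotwise_smooth_sum (I : Type) (r : seq I) (f : I -> M -> R) :
  (forall i, plotwise_smooth (f i)) -> plotwise_smooth (fun y => \sum_(i <- r) f i y).
Proof.
move=> H; elim: r => [|i r IH].
  by under eq_fun do rewrite big_nil; exact: plotwise_smooth_cst.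
by under eq_fun do rewrite big_cons; exact: plotwise_smoothD.
Qed.

Lemma plotwise_smooth_prod (I : Type) (r : seq I) (f : I -> M -> R) :
  (forall i, plotwise_smooth (f i)) -> plotwise_smooth (fun y => \prod_(i <- r) f i y).
Proof.
move=> H; elim: r => [|i r IH].
  by under eq_fun do rewrite big_nil; exact: plotwise_smooth_cst.
by under eq_fun do rewrite big_cons; exact: plotwise_smoothM.
Qed.

(** The second alternative fills the indices for which no chart is selected. *)
Lemma bump_cover : exists (psi : nat -> M -> R),
  [/\ forall i, plotwise_smooth (psi i), forall i y, 0 <= psi i y,
      forall y, exists i, 0 < psi i y &
      forall i, (exists c x e, [/\ charts_at x c, safe_radius c x e &
         psi i = chart_bump c x e]) \/ psi i = fun=> 0].
Proof.
pose I := {cxe : chart R M n * M * R |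
  charts_at cxe.1.2 cxe.1.1 /\ safe_radius cxe.1.1 cxe.1.2 cxe.2}.
pose bump (i : I) : M -> R := chart_bump (sval i).1.1 (sval i).1.2 (sval i).2.
have [_ sM _ _ _] := hM.
have [|g gP] := @lindelof M I (fun i => [set y | 0 < bump i y]) sM.
  move=> x; have [c cx] := charts_ex hM x; have [e re] := safe_radius_ex hM cx.
  exists (exist _ (c, x, e) (conj cx re)) => /=.
  have [cb _] := plotwise_smooth_bump hM cx re.
  have b0 : 0 < chart_bump c x e x := chart_bump_gt0 e cx.2.
  exact: (continuous_near (cb x) (near_gt b0)).
exists (fun i => if g i is Some j then bump j else fun=> 0); split.
- move=> i; case: (g i) => [[[[c x] e] [cx re]]|]; last exact: plotwise_smooth_cst.
  exact: plotwise_smooth_bump.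
- by move=> i y; case: (g i) => [j|//]; exact: chart_bump_ge0.
- by move=> y; have [i [j [gi jy]]] := gP y; exists i; rewrite gi.
- move=> i; case: (g i) => [[[[c x] e] [cx re]]|]; last by right.
  by left; exists c, x, e.
Qed.

(** To make the cover locally finite, multiply [psi i] (made flat) by factors which
    vanish as soon as some earlier [psi j] exceeds 1/(i+1).  Where [psi k > 0], all
    [i] large enough are killed near by.  At a given point the first [i] with
    [psi i > 0] survives, since the earlier [psi j] vanish there. *)
Lemma stepper_family :
  exists (b : nat -> M -> R) (st : nat -> tvec M -> R -> M -> M),
  [/\ forall i, stepper (b i) (st i), forall i, plotwise_smooth (b i),
      forall i y, 0 <= b i y, forall y, exists i, 0 < b i y &
      forall x : M, exists N, \forall y \near x, forall i, (N <= i)%N -> b i y = 0].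
Proof.
have [psi [ppsi psi0 cov psiE]] := bump_cover.
pose a i y := flat 0 (psi i y) * \prod_(j < i) flat 0 (i.+1%:R^-1 - psi j y).
have pa i : plotwise_smooth (a i).
  apply: plotwise_smoothM; first exact: plotwise_smooth_flat.
  apply: plotwise_smooth_prod => j; apply: plotwise_smooth_flat; apply: plotwise_smoothD.
    exact: plotwise_smooth_cst.
  have := plotwise_smoothM (plotwise_smooth_cst (-1 : R)) (ppsi j).
  by under eq_fun do rewrite mulN1r.
have supp i y : a i y != 0 -> psi i y != 0.
  by apply: contraNneq => p0; rewrite /a p0 flat_eq0// mul0r.
have /choice[st stP] : forall i, exists st, stepper (fun y => a i y ^+ 2) st.
  move=> i; have [[c [x [e [cx re E]]]]|E] := psiE i.
    apply: (chart_stepper hM cx re (pa i)).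
    by move=> y /supp; rewrite E.
  exists (fun _ _ y => y).
  have -> : (fun y => a i y ^+ 2) = fun=> 0; last exact: trivial_stepper.
  by apply/funext => y; rewrite /a E flat_eq0// mul0r expr0n.
exists (fun i y => a i y ^+ 2), st; split => //.
- by move=> i; have := plotwise_smoothM (pa i) (pa i); under eq_fun do rewrite -expr2.
- by move=> i y; exact: sqr_ge0.
- move=> y; have [i0 i0y] := cov y.
  have ex : exists i, 0 < psi i y by exists i0.
  pose i := ex_minn ex; exists i; rewrite /i.
  case: ex_minnP => {i}i iy imin.
  apply: exprn_gt0; apply: mulr_gt0; first exact: flat_gt0.
  apply: prodr_gt0 => j _; apply: flat_gt0.
  have -> : psi j y = 0.
    apply/eqP; rewrite eq_le psi0 andbT leNgt; apply/negP => /imin.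
    by rewrite leqNgt ltn_ord.
  by rewrite subr0 invr_gt0.
move=> x; have [k kx] := cov x.
have d0 : 0 < psi k x / 2 by rewrite divr_gt0.
have dx : psi k x / 2 < psi k x by rewrite ltr_pdivrMr// ltr_pMr// ltr1n.
have [N1 _ HN] := near_infty_natSinv_lt (PosNum d0).
exists (maxn k.+1 N1).
apply: filterS (continuous_near ((ppsi k).1 x) (near_gt dx)) => y ky i.
rewrite geq_max => /andP[ki Ni].
have E : flat 0 (i.+1%:R^-1 - psi k y) = 0.
  by apply: flat_eq0; rewrite subr_le0 ltW// (lt_trans (HN i Ni)).
by rewrite /a (bigD1 (Ordinal ki))//= E mul0r mulr0 expr0n.
Qed.

(** Apply all steppers one after the other, in time [s / S].  Near a given vector
    only finitely many steppers act, so that the infinite composition and the sum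
    [S] are locally finite ones; the velocities add up to [S / S = 1] times [v]. *)
Lemma local_addition : exists L : tvec M -> R -> M,
  [/\ forall (Z : topologicalType) (V : Z -> tvec M) (s : Z -> R) z,
        {for z, continuous V} -> {for z, continuous s} ->
        {for z, continuous (fun z => L (V z) (s z))},
      forall m (V : 'rV[R]_m -> TM) (s : 'rV[R]_m -> R) t,
        smooth_into V t -> smooth_at s t -> smooth_into (fun t => L (V t) (s t)) t &
      forall v, moves v 1 (L v)].
Proof.
have [b [st [stP pb b0 cov lf]]] := stepper_family.
have /choice[N NP] := lf.
pose B m y := \sum_(i < m) b i y.
have pB m : plotwise_smooth (B m) by exact: plotwise_smooth_sum.
have Bstab y m m' : (forall i, (m <= i)%N -> b i y = 0) -> (m <= m')%N ->
    B m' y = B m y.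
  move=> H /subnKC <-; rewrite /B big_split_ord/= [X in _ + X]big1 ?addr0//.
  by move=> i _; rewrite H// leq_addr.
(* [N] depends on the point without regularity: the partial sums stabilize past it *)
pose S y := B (N y) y.
have Nself y : forall i, (N y <= i)%N -> b i y = 0 := nbhs_singleton (NP y).
have Seq (x : M) : \forall y \near x, B (N x) y = S y.
  apply: filterS (NP x) => y H; rewrite /S.
  have E1 := Bstab _ _ (maxn (N x) (N y)) H (leq_maxl _ _).
  have E2 := Bstab _ _ (maxn (N x) (N y)) (Nself y) (leq_maxr _ _).
  by rewrite -E1 -E2.
have pS : plotwise_smooth S.
  split=> [x|m p t mp].
    by apply: (near_eq_continuous (Seq x)); exact: (pB _).1.
  apply: smooth_at_near ((pB (N (p t))).2 _ _ _ mp).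
  exact: (continuous_near (smooth_into_continuous mp) (Seq (p t))).
have S0 y : 0 < S y.
  have [i iy] := cov y; rewrite /S /B.
  have [iN|Ni] := ltnP i (N y).
    rewrite (bigD1 (Ordinal iN))//= ltr_pwDl// sumr_ge0// => j _; exact: b0.
  by move: iy; rewrite Nself// ltxx.
pose L := fix L (m : nat) v (s : R) : M :=
  if m is m'.+1 then st m' v (s * (S (tbase v))^-1) (L m' v s) else tbase v.
have Lstab v s m m' : (forall i, (m <= i)%N -> b i (tbase v) = 0) -> (m <= m')%N ->
    L m' v s = L m v s.
  move=> H; elim: m' => [|m' IH]; first by rewrite leqn0 => /eqP ->.
  rewrite leq_eqVlt => /predU1P[<- //|mm'].
  by rewrite /= (stepper_id (stP m'))// ?IH// H.
have Lloc (v : tvec M) : \forall v' \near v, forall s,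
    L (N (tbase v)) v' s = L (N (tbase v')) v' s.
  apply: filterS (continuous_near (@tbase_continuous R M hM v) (NP (tbase v))) => v' H s.
  have E1 := Lstab v' s _ (maxn (N (tbase v)) (N (tbase v'))) H (leq_maxl _ _).
  have E2 := Lstab v' s _ (maxn (N (tbase v)) (N (tbase v'))) (Nself _) (leq_maxr _ _).
  by rewrite -E1 -E2.
have Lc m (Z : topologicalType) (V : Z -> tvec M) (s : Z -> R) z :
    {for z, continuous V} -> {for z, continuous s} ->
    {for z, continuous (fun z => L m (V z) (s z))}.
  move=> cV cs; have cb : {for z, continuous (fun z => tbase (V z))}.
    by apply: (continuous_comp cV); exact: tbase_continuous.
  elim: m => [//|m IH] /=.
  apply: (stepper_cont (stP m)) => //.
  apply: continuousM => //; apply: continuousV; first by rewrite gt_eqF.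
  by apply: (continuous_comp cb); exact: pS.1.
have Ls m k (V : 'rV[R]_k -> TM) (s : 'rV[R]_k -> R) t :
    smooth_into V t -> smooth_at s t -> smooth_into (fun t => L m (V t) (s t)) t.
  move=> mV ss; have mb := tbase_smooth_into hM mV.
  elim: m => [//|m IH] /=.
  apply: (stepper_smooth (stP m)) => // d.
  apply: ckM; first exact: ss.
  by apply: ckV; [rewrite gt_eqF|exact: (pS.2 _ _ _ mb)].
have Lm m v : moves v (B m (tbase v) / S (tbase v)) (L m v).
  elim: m => [|m IH].
    rewrite /B big_ord0 mul0r /=; have [c cx] := charts_ex hM (tbase v).
    apply: (@moves_chart R M hM v 0 _ c) => //.
    - exact: cst_continuous.
    - exact: derivable_cst.
    - by rewrite scale0r; exact: derive_cst.
  have := stepper_moves (stP m) (S (tbase v))^-1 IH.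
  rewrite [_^-1 * _]mulrC -mulrDl.
  by rewrite {2}/B big_ord_recr.
exists (fun v s => L (N (tbase v)) v s); split.
- move=> Z V s z cV cs; apply: (near_eq_continuous _ (Lc (N (tbase (V z))) Z V s z cV cs)).
  by apply: filterS (continuous_near cV (Lloc (V z))) => w ->.
- move=> m V s t mV ss; apply: (smooth_into_near _ (Ls (N (tbase (V t))) m V s t mV ss)).
  by apply: filterS (continuous_near (smooth_into_continuous mV) (Lloc (V t))) => w ->.
move=> v; have := Lm (N (tbase v)) v.
by rewrite -/(S (tbase v)) divff// gt_eqF.
Qed.

End LocallyFinite.

(** * The isomorphism *)

Section Final.
Variables (R : realType) (M : mfd R).
Hypothesis hM : is_manifold M.
Local Notation TM := (tangent_bundle M).
Local Notation n := (mfd_dim M).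
Let hTM : is_manifold TM := tangent_manifold hM.

Lemma smooth_into_cst (N : mfd R) (hN : is_manifold N) m (x : N) (t : 'rV[R]_m) :
  smooth_into (fun=> x) t.
Proof.
have [c cx] := charts_ex hN x; apply: (@smooth_into_intro R N hN _ _ _ c) => //.
  by apply: near_all => _; exact: cx.2.
by move=> k; exact: ck_cst.
Qed.

Lemma velocity_class (E : tangent (mfd_sss M) -> mfd_sss TM) tau :
  is_velocity_map E -> is_velocity (tangent_repr tau) (E tau).
Proof. by move=> hE; rewrite -{2}(tangent_reprK tau); exact: hE. Qed.

Lemma velocity_map_proj E tau : is_velocity_map E ->
  tbase (E tau) = @tangent_proj R (mfd_sss M) tau.
Proof. by move=> hE; have [-> _] := velocity_class tau hE. Qed.

Lemma velocity_map_differential (N : mfd R) (f : M -> N) E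
    (EN : tangent (mfd_sss N) -> mfd_sss (tangent_bundle N))
    (hf : @sample_smooth R (mfd_sss M) (mfd_sss N) f) tau :
  is_manifold N -> smooth_map f -> is_velocity_map E -> is_velocity_map EN ->
  is_differential f (E tau) (EN (tangent_map (SssHom hf) tau)).
Proof.
move=> hN sf hE hEN; have [qx qc] := hEN (sss_comp (SssHom hf) (tangent_repr tau)).
have [px pc] := velocity_class tau hE.
split; first by rewrite qx px.
move=> c d; rewrite px => cx dx.
have gk := curve_germ hM (tangent_repr tau) 0.
have [_ D] := derive_curve hM hN sf (germ_continuous gk) cx dx (germ_derivable hM gk cx).
by rewrite (qc d dx) (pc c cx) !derive1E; exact: D.
Qed.

(** Unlike [c] itself, which is arbitrary outside its domain, this is a Borel map on
    [M]. *)
Definition chart_ext (c : chart R M n) (y : M) : 'rV[R]_n :=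
  if `[< chart_dom c y >] then c y else 0.

Lemma borel_chart_ext c (f : Omega R -> M) : is_local_homeo c ->
  borel_measurable f -> borel_measurable (chart_ext c \o f).
Proof.
move=> hc /borel_measurableP bf; apply/borel_measurableP => U oU.
have oD : open (chart_dom c `&` c @^-1` U).
  rewrite openE => y [cy Uy]; rewrite /interior.
  apply: filterS2 (chart_dom_near hc cy) (chart_continuous hc cy (open_nbhs_nbhs (conj oU Uy))).
  by [].
have [U0|U0] := pselect (U 0).
  rewrite (_ : _ @^-1` _ = f @^-1` (chart_dom c `&` c @^-1` U) `|` ~` (f @^-1` chart_dom c)).
    apply: measurableU; first exact: bf.
    by apply: measurableC; apply: bf; exact: chart_open.
  apply/seteqP; split=> w /=; rewrite /chart_ext.
    by case: asboolP => cy Uy; [left|right].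
  by case: asboolP => cy [[]|].
rewrite (_ : _ @^-1` _ = f @^-1` (chart_dom c `&` c @^-1` U)); first exact: bf.
by apply/seteqP; split=> w /=; rewrite /chart_ext; case: asboolP => // cy [].
Qed.

Lemma fst_coord_continuous (T : topologicalType) k (i : 'I_k) :
  continuous (fun ab : 'rV[R]_k * T => ab.1 0 i : R).
Proof.
move=> ab; have c := @coord_continuous R 1 k 0 i ab.1.
exact: (@continuous_comp _ _ _ fst (fun u : 'rV[R]_k => u 0 i) ab cvg_fst c).
Qed.

Lemma snd_coord_continuous (T : topologicalType) k (i : 'I_k) :
  continuous (fun ab : T * 'rV[R]_k => ab.2 0 i : R).
Proof.
move=> ab; have c := @coord_continuous R 1 k 0 i ab.2.
exact: (@continuous_comp _ _ _ snd (fun u : 'rV[R]_k => u 0 i) ab cvg_snd c).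
Qed.

Lemma harmonic_dnbhs : (fun k : nat => k.+1%:R^-1 : R) @ \oo --> (0 : R)^'.
Proof.
move=> A /=; rewrite /dnbhs /within/= => /nbhs_ballP[e /= e0 He].
apply: filterS (near_infty_natSinv_lt (PosNum e0)) => k /= ke.
apply: He; last by rewrite gt_eqF// invr_gt0.
by rewrite -ball_normE/= sub0r normrN ger0_norm// invr_ge0.
Qed.

Section EvalPlot.
Variables (k : nat) (F : Omega_ R k -> curve (mfd_sss M)).
Hypothesis pF : @plot R (fun_sss (real_sss R) (mfd_sss M)) k F.

(** The plot of curves [F] as a plot of [M], with time as the last variable. *)
Definition eval_plot (u : Omega_ R (k + 1)) : M :=
  F (lsubmx u.1, u.2) ((rsubmx u.1 : 'rV[R]_1) 0 0).

Lemma eval_plot_plot : @plot R (mfd_sss M) _ eval_plot.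
Proof.
pose h (u : Omega_ R (k + 1)) : Omega_ R k := (lsubmx u.1, u.2).
apply: (pF (h := h) (q := fun u => (rsubmx u.1 : 'rV[R]_1) 0 0)).
  exists (fun u => lsubmx u.1), id; split=> //.
  apply/mixed_smoothP; split=> [w t|t]; first exact: smooth_at_lsubmx.
  exact: (borel_cst (lsubmx t)).
apply/real_plotP; split=> [w t d|t].
  exact: (ck_row _ _ _).1 (@smooth_at_rsubmx R k 1 t d) 0.
exact: (borel_cst ((rsubmx t : 'rV[R]_1) 0 0)).
Qed.

Lemma eval_plotE t s w :
  eval_plot (row_mx t (const_mx s : 'rV[R]_1), w) = F (t, w) s.
Proof. by rewrite /eval_plot row_mxKl row_mxKr mxE. Qed.

Lemma derive_eval_plot c t w :
  derive1 (c \o (F (t, w) : R -> M) : R -> 'rV[R]_n) 0 =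
  'D_(ebase (rshift k 0)) (fun z => c (eval_plot (z, w)))
    (row_mx t (const_mx 0 : 'rV[R]_1)).
Proof.
rewrite /derive1 /derive.
set A := (X in lim (X @ _) = _); set B := (X in _ = lim (X @ _)).
suff -> : A = B by [].
apply/funext => h; rewrite /A /B /=.
rewrite eval_plotE.
have -> : h *: ebase (rshift k 0) + row_mx t (const_mx 0 : 'rV[R]_1) =
    row_mx t (const_mx (h + 0) : 'rV[R]_1).
  apply/rowP => j; rewrite mxE [X in X + _]mxE [X in _ * X]mxE eqxx/=.
  case: (splitP j) => i ij.
    have -> : j = lshift 1 i by exact/val_inj.
    by rewrite !row_mxEl eq_lrshift mulr0 add0r.
  have -> : j = rshift k 0 by apply/val_inj; rewrite /= ij ord1.
  by rewrite !row_mxEr !mxE eqxx mulr1.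
by rewrite eval_plotE.
Qed.

Variable v : Omega_ R k -> TM.
Hypothesis hv : forall u, is_velocity (F u) (v u).

(** In a chart, the velocity is the partial derivative of [eval_plot] in time,
    restricted to time 0. *)
Lemma velocity_plot_smooth w t : smooth_into (fun t => v (t, w)) t.
Proof.
have /(mfd_plotP hM)[sG _] := eval_plot_plot.
pose inj0 (t : 'rV[R]_k) : 'rV[R]_(k + 1) := row_mx t (const_mx 0 : 'rV[R]_1).
have sinj t' : smooth_at inj0 t'.
  by apply: smooth_at_row; [exact: smooth_at_id|move=> d; exact: ck_cst].
have vb t' : tbase (v (t', w)) = eval_plot (inj0 t', w).
  by rewrite eval_plotE; have [] := hv (t', w).
have mb : smooth_into (fun t' => eval_plot (inj0 t', w)) t.
  have := smooth_into_pre (sinj t) (sG w (inj0 t)); exact.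
have [c cx] := charts_ex hM (tbase (v (t, w))).
have nb : \forall t' \near t, chart_dom c (tbase (v (t', w))).
  have cb : {for t, continuous (fun t' => tbase (v (t', w)))}.
    have -> : (fun t' => tbase (v (t', w))) = (fun t' => eval_plot (inj0 t', w)).
      by apply/funext.
    exact: smooth_into_continuous mb.
  exact: (continuous_near cb (chart_dom_near (charts_homeo hM cx) cx.2)).
apply: (@smooth_into_intro R TM hTM _ _ _ (lift_chart c)) => //.
  by split; [exists c; [exact: cx.1|]|exact: cx.2].
have cx' : charts_at (eval_plot (inj0 t, w)) c by rewrite -vb.
have sc := smooth_into_chart hM (sG w (inj0 t)) cx'.
have S := smooth_at_row (smooth_at_comp (sinj t) sc)
  (smooth_at_comp (sinj t) (smooth_at_derive (rshift k 0) sc)).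
apply: smooth_at_near S; apply: filterS nb => t' ct'.
have [_ /(_ c) vc] := hv (t', w).
have bF : tbase (v (t', w)) = F (t', w) 0 by have [] := hv (t', w).
rewrite /= /tchart vc; last by split; [exact: cx.1|rewrite -bF].
by rewrite derive_eval_plot vb.
Qed.

(** Over each of countably many charts, the velocity is the limit of the difference
    quotients at times 1/(k+1), which are Borel maps into R^2n. *)
Lemma velocity_plot_borel t : borel_measurable (fun w => v (t, w)).
Proof.
have /(mfd_plotP hM)[sG bG] := eval_plot_plot.
have bF s : borel_measurable (fun w => F (t, w) s : M).
  have := bG (row_mx t (const_mx s : 'rV[R]_1)).
  by under eq_fun do rewrite eval_plotE.
have [g [ga gcov]] := countable_atlas hM.
apply/borel_measurableP => W oW.
pose P i : set (Omega R) := if g i is Some c then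
    (fun w => F (t, w) 0 : M) @^-1` chart_dom c `&`
    (fun w => tchart c (v (t, w))) @^-1`
      (tchart c @` ([set p : tvec M | chart_dom c (tbase p)] `&` W))
  else set0.
have vb w : tbase (v (t, w)) = F (t, w) 0 by have [] := hv (t, w).
rewrite (_ : _ @^-1` _ = \bigcup_i P i); last first.
  apply/seteqP; split=> w.
    move=> Ww; have [i [c [gi cx]]] := gcov (tbase (v (t, w))).
    exists i => //; rewrite /P gi; split; first by rewrite /= -vb; exact: cx.2.
    by exists (v (t, w)) => //; split=> //; exact: cx.2.
  move=> [i _]; rewrite /P; case E : (g i) => [c|//] [/= cw [p [cp Wp] pv]].
  have -> // : v (t, w) = p.
  by apply: (lift_chart_inj hM (ga _ _ E)) => //; rewrite vb.
apply: bigcupT_measurable => i; rewrite /P; case gi : (g i) => [c|]; last exact: measurable0.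
have ac := ga _ _ gi; have hc := atlas_homeo hM ac.
pose f k' w : 'rV[R]_(n + n) :=
  row_mx (chart_ext c (F (t, w) 0))
   (k'.+1%:R *: (chart_ext c (F (t, w) k'.+1%:R^-1) - chart_ext c (F (t, w) 0))).
apply: (@borel_limit R _ _ f) => //.
- exact: second_countable_row.
- exact: regular_row.
- by move/borel_measurableP: (bF 0); apply; exact: chart_open.
- move=> k'.
  pose H (ab : 'rV[R]_n * 'rV[R]_n) : 'rV[R]_(n + n) :=
    row_mx ab.1 (k'.+1%:R *: (ab.2 - ab.1)).
  have cH : continuous H.
    move=> ab; apply/continuous_rowP => j.
    have c1 i' := @fst_coord_continuous 'rV[R]_n n i' ab.
    have c2 i' := @snd_coord_continuous 'rV[R]_n n i' ab.
    case: (splitP j) => i' ij.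
      have -> : j = lshift n i' by exact/val_inj.
      have -> : (fun y => H y 0 (lshift n i')) = (fun ab => ab.1 0 i').
        by apply/funext => y; rewrite /H row_mxEl.
      exact: c1.
    have -> : j = rshift n i' by exact/val_inj.
    have -> : (fun y => H y 0 (rshift n i')) = (fun ab => k'.+1%:R * (ab.2 0 i' - ab.1 0 i')).
      by apply/funext => y; rewrite /H row_mxEr !mxE.
    apply: continuousM; first exact: cst_continuous.
    by apply: continuousB; [exact: c2|exact: c1].
  apply: (@borel_comp R _ _ H (fun w => (chart_ext c (F (t, w) 0),
            chart_ext c (F (t, w) k'.+1%:R^-1))) cH).
  apply: borel_pair; [exact: second_countable_row|exact: second_countable_row| | ].
    exact: borel_chart_ext (bF 0).
  exact: borel_chart_ext (bF _).
- move=> w cw.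
  have cx : charts_at (F (t, w) 0 : M) c by split.
  have gk := curve_germ hM (F (t, w)) 0.
  have cg := germ_continuous gk.
  have dg := germ_derivable hM gk cx.
  have [_ /(_ c cx) vc] := hv (t, w).
  rewrite /tchart vc vb derive1E.
  have D : (fun h : R => h^-1 *: (c (F (t, w) h) - c (F (t, w) 0))) @ 0^' -->
      'D_1 (c \o (F (t, w) : R -> M)) 0.
    have := dg; rewrite /derivable /derive /=.
    by under eq_fun do rewrite addr0 [_ *: 1]mulr1.
  have D' := cvg_comp _ _ harmonic_dnbhs D.
  have nd : \forall h \near (0 : R)^', chart_dom c (F (t, w) h).
    apply: cvg_within.
    exact: (continuous_near cg (chart_dom_near hc cw)).
  have nd' : \forall k' \near \oo, chart_dom c (F (t, w) k'.+1%:R^-1).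
    exact: harmonic_dnbhs nd.
  have E0 : chart_ext c (F (t, w) 0) = c (F (t, w) 0).
    by rewrite /chart_ext ifT//; exact/asboolP.
  apply/cvg_rowP => j.
  case: (splitP j) => i' ij.
    have -> : j = lshift n i' by exact/val_inj.
    under eq_fun do rewrite row_mxEl E0.
    by rewrite row_mxEl; exact: cvg_cst.
  have -> : j = rshift n i' by exact/val_inj.
  under eq_fun do rewrite row_mxEr E0.
  rewrite row_mxEr; have D2 := (cvg_rowP _ _).1 D' i'.
  apply: (cvg_trans _ (D2 _)); apply: near_eq_cvg.
  apply: filterS nd' => k' ck'.
  by rewrite /= invrK {1}/chart_ext ifT//; exact/asboolP.
- have := lift_chart_homeo hM ac => -[_ _ _ H]; apply: H; first exact: subIsetl.
  by apply: openI => //; exact: (chart_open (lift_chart_homeo hM ac)).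
Qed.

End EvalPlot.

Lemma velocity_map_smooth E : is_velocity_map E ->
  @sample_smooth R (tangent (mfd_sss M)) (mfd_sss TM) E.
Proof.
move=> hE k p [[y ->]|[F pF ->]].
  exact: ((is_sss_mfd hTM).1 k (E y)).
have hv u : is_velocity (F u) (E (tangent_class (F u))) by exact: hE.
apply/(mfd_plotP hTM); split=> [w t|t].
  exact: (velocity_plot_smooth pF hv).
exact: (velocity_plot_borel pF hv).
Qed.

(** A vector [v] is sent to the class of [L v], with [L] the local addition, and
    thus a plot [p] of vectors to the class of the plot of curves [L (p -)]. *)
Lemma velocity_map_inverse E : is_velocity_map E ->
  exists g : mfd_sss TM -> tangent (mfd_sss M),
    [/\ cancel E g, cancel g E & sample_smooth g].
Proof.
move=> hE; have [L [Lc Ls Lm]] := local_addition hM.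
have Lcurve (v : tvec M) : @sample_smooth R (real_sss R) (mfd_sss M) (L v).
  apply: (sample_smooth_curve hM).
    move=> s; apply: (Lc R (fun=> v) id); [exact: cst_continuous|exact: cvg_id].
  by move=> m s t ss; apply: (Ls m (fun=> v) s t) => //; exact: smooth_into_cst.
pose gam v : curve (mfd_sss M) := SssHom (Lcurve v).
have Lv v : is_velocity (gam v) v.
  have [L0 _ LD] := Lm v; split=> [|c]; first by rewrite /= L0.
  rewrite /= L0 => /LD[_]; rewrite scale1r derive1E => <-.
  by [].
exists (fun v => tangent_class (gam v)); split.
- move=> tau; rewrite -[RHS]tangent_reprK.
  apply/tangent_classP; apply: (velocity_inj hM (Lv (E tau))).
  exact: velocity_class.
- by move=> v; apply: (velocity_uniq hM (hE (gam v))); exact: Lv.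
move=> k p pp; right; exists (fun u => gam (p u)) => // m h q sh /real_plotP[sq bq].
have /(mfd_plotP hTM)[sp bp] := (is_sss_mfd hTM).2 _ _ _ _ pp sh.
apply/(mfd_plotP hM); split=> [w t|t] /=.
  exact: (Ls m (fun t => p (h (t, w))) (fun t => q (t, w)) t (sp w t) (sq w t)).
pose H (vs : tvec M * 'rV[R]_1) : M := L vs.1 (vs.2 0 0).
have cH : continuous H.
  move=> vs; apply: (Lc _ fst (fun vs : tvec M * 'rV[R]_1 => vs.2 0 0)).
    exact: cvg_fst.
  exact: snd_coord_continuous.
have cc : continuous (fun x : R => const_mx x : 'rV[R]_1).
  by move=> x; exact: (differentiable_continuous (const_mx_differentiable x)).
have bH := borel_comp cH (borel_pair (tangent_second_countable hM)
   (@second_countable_row R 1) (bp t) (borel_comp cc (bq t))).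
by move: bH; rewrite /comp /H; under eq_fun do rewrite /= mxE.
Qed.

End Final.

Theorem proposition4p36 (R : realType) (M : mfd R) (hM : is_manifold M) :
  [/\ is_sss (mfd_sss M),
      is_manifold (tangent_bundle M) &
      exists E : tangent (mfd_sss M) -> mfd_sss (tangent_bundle M),
        [/\ is_velocity_map E,
            sss_iso E,
            (forall tau, tbase (E tau) = tangent_proj tau) &
            forall (N : mfd R) (f : M -> N)
              (EN : tangent (mfd_sss N) -> mfd_sss (tangent_bundle N)),
              is_manifold N -> smooth_map f -> is_velocity_map EN ->
              exists hf : @sample_smooth R (mfd_sss M) (mfd_sss N) f,
                forall tau, is_differential f (E tau)
                              (EN (tangent_map (SssHom hf) tau))]].
Proof.
split; [exact: is_sss_mfd|exact: tangent_manifold|].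
have [E hE] := velocity_map_ex hM; exists E; split => //.
- split.
  + exact: is_sss_tangent.
  + exact/is_sss_mfd/tangent_manifold.
  + exact: velocity_map_smooth.
  + exact: velocity_map_inverse.
- by move=> tau; exact: velocity_map_proj.
move=> N f EN hN sf hEN.
exists (sample_smooth_smooth_map hM hN sf) => tau.
exact: velocity_map_differential.
Qed.
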